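(* Let $n\ge2$, $\mathbb{R}^n_+=\{x\in\mathbb{R}^n:x_1>0\}$, $1\le k\le n-1$, and let $\alpha_1,\ldots,\alpha_k$ be nonpositive constants. Define \[ \beta_1=-\alpha_1^2+\tfrac14,\qquad \beta_m=-\alpha_m^2+\left(\alpha_{m-1}-\tfrac12\right)^2,\quad m=2,\ldots,k. \] Suppose there exists a constant $\beta_{k+1}$ such that for all $u\in C_0^\infty(\mathbb{R}^n_+)$ \[ \int_{\mathbb{R}^n_+}|\nabla u|^2dx\ \ge\ \int_{\mathbb{R}^n_+}\left(\frac{\beta_1}{x_1^2}+\frac{\beta_2}{x_1^2+x_2^2}+\cdots+\frac{\beta_{k+1}}{x_1^2+\cdots+x_{k+1}^2}\right)u^2dx. \] Then $\beta_{k+1}\le\left(\alpha_k-\tfrac12\right)^2$. Moreover, \[ \inf_{0\ne u\in C_0^\infty(\mathbb{R}^n_+)}\frac{\int_{\mathbb{R}^n_+}|\nabla u|^2dx-\beta_1\int_{\mathbb{R}^n_+}\frac{|u|^2}{x_1^2}dx-\cdots-\beta_k\int_{\mathbb{R}^n_+}\frac{|u|^2}{x_1^2+\cdots+x_k^2}dx}{\int_{\mathbb{R}^n_+}\frac{|u|^2}{x_1^2+\cdots+x_{k+1}^2}dx}=\left(\alpha_k-\tfrac12\right)^2. \] *)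

(* Defs.v *)
From HB Require Import structures.
From mathcomp Require Import all_boot all_order all_algebra.
From mathcomp Require Import all_classical all_reals all_analysis.
Set Implicit Arguments. Unset Strict Implicit. Unset Printing Implicit Defensive.
Import Order.TTheory GRing.Theory Num.Theory.
Import numFieldNormedType.Exports.
Local Open Scope classical_set_scope.
Local Open Scope ring_scope.

Definition partial {R : realType} {n : nat} (i : 'I_n) (f : 'rV[R]_n -> R)
  : 'rV[R]_n -> R := fun x => 'D_(delta_mx 0 i) f x.

Fixpoint iter_partial {R : realType} {n : nat} (s : seq 'I_n) (f : 'rV[R]_n -> R)
  : 'rV[R]_n -> R :=
  match s with [::] => f | i :: s' => partial i (iter_partial s' f) end.

Definition smooth {R : realType} {n : nat} (f : 'rV[R]_n -> R) : Prop :=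
  forall s : seq 'I_n, continuous (iter_partial s f) /\
    forall (i : 'I_n) (x : 'rV[R]_n), derivable (iter_partial s f) x (delta_mx 0 i).

Definition halfspace (R : realType) (n : nat) : set 'rV[R]_n :=
  [set x | forall j : 'I_n, nat_of_ord j = 0%N -> 0 < x 0 j].

Definition C0inf_half {R : realType} {n : nat} (u : 'rV[R]_n -> R) : Prop :=
  smooth u /\ exists K : set 'rV[R]_n,
    compact K /\ K `<=` @halfspace R n /\ forall x, ~ K x -> u x = 0.

Fixpoint iint {R : realType} (n : nat) : ('rV[R]_n -> R) -> R :=
  match n with
  | 0 => fun f => f 0
  | n'.+1 => fun f => Rintegral lebesgue_measure setT
       (fun t : R => iint (fun v : 'rV[R]_n' => f (row_mx (const_mx t : 'rV[R]_1) v)))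
  end.

Definition gradsq {R : realType} {n : nat} (u : 'rV[R]_n -> R) (x : 'rV[R]_n) : R :=
  \sum_(i < n) (partial i u x) ^+ 2.

Definition rsq {R : realType} {n : nat} (m : nat) (x : 'rV[R]_n) : R :=
  \sum_(j < n | (j < m)%N) (x 0 j) ^+ 2.

Definition hbeta {R : realType} (alpha : nat -> R) (m : nat) : R :=
  if m == 1%N then - alpha 1%N ^+ 2 + 4^-1
  else - alpha m ^+ 2 + (alpha m.-1 - 2^-1) ^+ 2.

(* Main.v *)
(* Write X_m = (x_1, ..., x_m) and put alpha_{k+1} := 0, so that beta_{k+1} is
   (alpha_k - 1/2)^2.  The function phi = prod_{m <= k+1} |X_m|^{g_m}, with
   exponents g_m read off the alpha_m, solves
   - Delta phi = (sum_{m <= k+1} beta_m / |X_m|^2) phi, and integrating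
   div (u^2 grad phi / phi) gives
     int |grad u|^2 - sum_{m <= k+1} beta_m int u^2 / |X_m|^2
       = int |grad u - u grad phi / phi|^2 >= 0.
   For the sharpness take u = phi psi, where psi is a product of cutoffs at
   scales L_j in the variables ln |X_1|^2, ln (|X_{j+1}|^2 / |X_j|^2) for
   j <= k, and x_j beyond.  The right-hand side is then int phi^2 |grad psi|^2.
   In the coordinates x_{j+1} / |X_j| it is bounded by a sum of products of
   one-dimensional integrals, and int u^2 / |X_{k+1}|^2 is such a product.
   Since alpha_j <= 0, the weight of the j-th gradient factor is at most
   (1 + s^2)^{-1/2}, for which a logarithmic cutoff has arbitrarily small
   energy; the scales are chosen one after the other. *)
Require Import Defs.
From HB Require Import structures.
From mathcomp Require Import all_boot all_order all_algebra.
From mathcomp Require Import all_classical all_reals all_analysis.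
From mathcomp Require Import ring lra.
Import Order.TTheory GRing.Theory Num.Theory.
Import numFieldNormedType.Exports.
Local Open Scope classical_set_scope.
Local Open Scope ring_scope.

Set Implicit Arguments. Unset Strict Implicit. Unset Printing Implicit Defensive.

(** The value 0 of alpha_{k+1} maximises beta_{k+1} = -alpha_{k+1}^2 + (alpha_k - 1/2)^2, which is
    why the sequence is continued in this way. The resulting phi is a borderline function: in the
    variable ln |X_1|^2 the integral of phi^2 / |X_{k+1}|^2 carries the flat measure of the whole
    line, and when alpha_j = 0 the gradient weight in s = x_{j+1} / |X_j| decays only like 1/|s|.
    Hence the logarithmic variables in psi. The obstacle is that the gradient of the j-th cutoff
    brings 1/|X_j|^2, whereas the denominator has 1/|X_{k+1}|^2. The two differ by factors in all
    layers from j to k, so the energy of cutoff j is multiplied by constants that depend on the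
    scales of the later layers; these must be fixed before L_j. All integrals are iterated
    one-dimensional ones, and the order of integration is never exchanged: |X_j| involves only
    coordinates that precede x_{j+1}, so each substitution happens in a single integral over the
    line, where the fundamental theorem of calculus is enough. *)

Section RealLineIntegral.
Context {R : realType}.
Implicit Types (f g : R -> R) (M : R).

Lemma mvt_closed (G f : R -> R) (a b : R) : a < b ->
  (forall x, a <= x <= b -> is_derive x 1 G (f x)) ->
  exists2 c, a <= c <= b & G b - G a = f c * (b - a).
Proof.
move=> ab dG.
have [c cab E] : exists2 c, c \in `]a, b[ & G b - G a = f c * (b - a).
  apply: MVT => //.
    by move=> x; rewrite in_itv /= => /andP[ax xb]; apply: dG; rewrite !ltW.
  apply: derivable_within_continuous => x; rewrite in_itv /= => xab.
  by have [] := dG _ xab.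
by exists c => //; move: cab; rewrite in_itv /= => /andP[ax xb]; rewrite !ltW.
Qed.

(** The class on which [Rintegral] is computed through antiderivatives, so that linearity, scaling
    and translation carry no integrability conditions. *)
Definition compsupp M f := continuous f /\ forall x, M < `|x| -> f x = 0.

Lemma Rintegral_supp f (a b : R) : (forall x, ~~ (a <= x <= b) -> f x = 0) ->
  Rintegral lebesgue_measure setT f = Rintegral lebesgue_measure `[a, b] f.
Proof.
move=> f0; rewrite [RHS]Rintegral_mkcond; congr (Rintegral _ _ _).
apply/funext => x; rewrite patchE; case: ifPn => // /negP H.
apply: f0; apply/negP => xab; apply: H.
by rewrite inE /= in_itv.
Qed.

Lemma Rintegral_FTC f (G : R -> R) (a b : R) : a < b -> continuous f ->
  (forall x, ~~ (a <= x <= b) -> f x = 0) ->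
  (forall x, a <= x <= b -> is_derive x 1 G (f x)) ->
  Rintegral lebesgue_measure setT f = G b - G a.
Proof.
move=> ab cf f0 dG; rewrite (Rintegral_supp f0) /Rintegral.
rewrite (continuous_FTC2 (F := G) ab) //.
- exact: continuous_subspaceT.
- have dc x : a <= x <= b -> {for x, continuous G}.
    move=> xab; have [+ _] := dG _ xab.
    by move/derivable1_diffP/differentiable_continuous.
  split.
  + by move=> x; rewrite in_itv /= => /andP[ax xb]; have [|//] := dG x; rewrite !ltW.
  + by apply: cvg_at_right_filter; apply: dc; rewrite lexx ltW.
  + by apply: cvg_at_left_filter; apply: dc; rewrite lexx ltW.
- move=> x; rewrite in_itv /= => /andP[ax xb].
  by rewrite derive1E; have [|_ ->//] := dG x; rewrite !ltW.
Qed.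

Lemma ex_antiderivative f (a b : R) : continuous f ->
  exists G : R -> R, forall x, a <= x <= b -> is_derive x 1 G (f x).
Proof.
move=> cf; exists (fun x => Rintegral lebesgue_measure [set` `[a - 1, x]] f).
move=> x /andP[ax xb].
have [||||dG eG] := @continuous_FTC1_closed R f (a - 1) x (b + 1).
- lra.
- apply: continuous_compact_integrable; first exact: segment_compact.
  exact: continuous_subspaceT.
- lra.
- exact: cf.
by apply: DeriveDef; [exact: dG|rewrite -derive1E; exact: eG].
Qed.

(** Every large enough [N] serves, so several functions can be treated on one common interval. *)
Lemma compsupp_ex M f : compsupp M f -> exists2 K : R, 0 < K & forall N : R, K <= N ->
  exists G : R -> R, (forall x : R, - N <= x <= N -> is_derive x 1 G (f x)) /\
    Rintegral lebesgue_measure setT f = G N - G (- N).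
Proof.
case=> cf f0; exists (`|M| + 1) => [|N MN]; first by rewrite ltr_wpDl.
have [G dG] := ex_antiderivative (- N) N cf; exists G; split=> //.
apply: Rintegral_FTC => //; first by have := normr_ge0 M; lra.
move=> x; rewrite -ler_norml -ltNge => xN; apply: f0.
by apply: lt_trans xN; apply: lt_le_trans MN; rewrite (le_lt_trans (ler_norm M)) // ltrDl.
Qed.

Lemma compsuppW M N f : M <= N -> compsupp M f -> compsupp N f.
Proof. by move=> MN [cf f0]; split=> // x Nx; apply: f0; apply: le_lt_trans Nx. Qed.

Lemma Rintegral_lin M N f g (c : R) : compsupp M f -> compsupp N g ->
  Rintegral lebesgue_measure setT (fun x => c * f x + g x) =
  c * Rintegral lebesgue_measure setT f + Rintegral lebesgue_measure setT g.
Proof.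
move=> cf cg; have [Kf Kf0 Hf] := compsupp_ex cf; have [Kg Kg0 Hg] := compsupp_ex cg.
pose K := Num.max (Num.max Kf Kg) (Num.max M N).
have [F [dF ->]] := Hf K ltac:(by rewrite !le_max lexx).
have [G [dG ->]] := Hg K ltac:(by rewrite !le_max lexx orbT).
have K0 : 0 < K by rewrite !lt_max Kf0.
apply: etrans; first apply: (@Rintegral_FTC _ (fun x => c * F x + G x) (- K) K).
- by lra.
- move=> x; apply: cvgD; last exact: cg.1.
  by apply: continuousM; [exact: cst_continuous|exact: cf.1].
- move=> x; rewrite -ler_norml -ltNge !gt_max => /andP[_ /andP[Mx Nx]].
  by rewrite cf.2 // cg.2 // mulr0 addr0.
- move=> x xK; have dFx := dF _ xK; have dGx := dG _ xK.
  have -> : c * f x + g x = c *: f x + g x by [].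
  exact: (@is_deriveD R R R (c *: F) G).
- by rewrite /=; ring.
Qed.

Lemma Rintegral_le M N f g : compsupp M f -> compsupp N g ->
  (forall x, f x <= g x) ->
  Rintegral lebesgue_measure setT f <= Rintegral lebesgue_measure setT g.
Proof.
move=> cf cg fg; rewrite -subr_ge0.
have := Rintegral_lin (-1) cf cg; rewrite mulN1r addrC => <-.
by apply: Rintegral_ge0 => x _; have := fg x; lra.
Qed.

Lemma Rintegral_gt0 M f (x0 : R) : compsupp M f -> (forall x, 0 <= f x) -> 0 < f x0 ->
  0 < Rintegral lebesgue_measure setT f.
Proof.
move=> cf f0 fx0; have [K K0 HK] := compsupp_ex cf.
have /cvgrPdist_lt /(_ _ fx0) := cf.1 x0.
rewrite -nbhs_nearE => /nbhs_ballP[d /= d0 Hd].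
pose e := d / 2; have e0 : 0 < e by rewrite divr_gt0.
pose N := Num.max K (`|x0| + e + 1).
have KN : K <= N by rewrite le_max lexx.
have xN : `|x0| + e + 1 <= N by rewrite le_max lexx orbT.
have [G [dG ->]] := HK _ KN.
have h1 := ler_norm x0; have h2 := ler_norm (- x0); rewrite normrN in h2.
have sub (a b : R) : - N <= a -> a < b -> b <= N ->
    exists2 c, a <= c <= b & G b - G a = f c * (b - a).
  move=> Na ab bN; apply: mvt_closed => // x /andP[ax xb]; apply: dG.
  by rewrite (le_trans Na ax) (le_trans xb bN).
(* The mean value theorem on three pieces: the outer two contribute nonnegatively, the middle one
   strictly, since there [f] stays within [f x0] of [f x0]. *)
have [c1 _ E1] := sub (- N) (x0 - e) ltac:(lra) ltac:(lra) ltac:(lra).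
have [c2 c2e E2] := sub (x0 - e) (x0 + e) ltac:(lra) ltac:(lra) ltac:(lra).
have [c3 _ E3] := sub (x0 + e) N ltac:(lra) ltac:(lra) ltac:(lra).
have fc2 : 0 < f c2.
  have := Hd c2; rewrite /ball /= => /(_ _).
  have -> : (`|x0 - c2| < d) = true.
    by apply/idP; rewrite ltr_norml; move: c2e e0; rewrite /e => /andP[]; lra.
  by move=> /(_ isT); rewrite ltr_norml => /andP[]; lra.
have p1 : 0 <= f c1 * (x0 - e - - N) by rewrite mulr_ge0 //; lra.
have p3 : 0 <= f c3 * (N - (x0 + e)) by rewrite mulr_ge0 //; lra.
have p2 : 0 < f c2 * (x0 + e - (x0 - e)) by rewrite mulr_gt0 //; lra.
by move: E1 E2 E3 p1 p2 p3; lra.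
Qed.

Lemma normr_Rintegral_le M f (C : R) : 0 <= M -> 0 <= C -> compsupp M f ->
  (forall x, `|f x| <= C) -> `|Rintegral lebesgue_measure setT f| <= C * (2 * (M + 1)).
Proof.
move=> M0 C0 [cf f0] fC.
have [G dG] := ex_antiderivative (- (M + 1)) (M + 1) cf.
rewrite (Rintegral_FTC (a := - (M + 1)) (b := M + 1) _ cf _ dG); first last.
- by move=> x; rewrite -ler_norml -ltNge => xN; apply: f0; lra.
- by lra.
have [|c _ ->] := @mvt_closed G f (- (M + 1)) (M + 1) _ dG; first by lra.
rewrite normrM ler_pM // ger0_norm; lra.
Qed.

Lemma Rintegral_scale M f (r : R) : 0 < r -> compsupp M f ->
  Rintegral lebesgue_measure setT (fun t => f (t / r) / r) =
  Rintegral lebesgue_measure setT f.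
Proof.
move=> r0 cf; have [K K0 HK] := compsupp_ex cf.
pose N := Num.max K M; have KN : K <= N by rewrite le_max lexx.
have [G [dG ->]] := HK _ KN.
have N0 : 0 < N by lra.
apply: etrans; first apply: (@Rintegral_FTC _ (fun t => G (t / r)) (- (N * r)) (N * r)).
- by have := mulr_gt0 N0 r0; lra.
- move=> x; apply: cvgM; last exact: cvg_cst.
  have c1 : {for x, continuous (fun t : R => t / r)}.
    by apply: cvgM; [exact: cvg_id|exact: cvg_cst].
  exact: (continuous_comp c1 (cf.1 _)).
- move=> x; rewrite -ler_norml -ltNge => xN; rewrite cf.2 ?mul0r //.
  rewrite normrM normfV (gtr0_norm r0) ltr_pdivlMr //.
  apply: le_lt_trans xN; apply: ler_wpM2r; first exact: ltW.
  by rewrite /N le_max lexx orbT.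
- move=> x xK.
  have xr : - N <= x / r <= N by rewrite ler_pdivlMr // ler_pdivrMr // mulNr.
  have dGx := dG _ xr.
  have dr : is_derive x 1 (fun t : R => t / r) r^-1.
    have -> : (fun t : R => t / r) = r^-1 \*: (id : R -> R).
      by apply/funext => t /=; rewrite mulrC.
    have := @is_deriveZ R R R (id : R -> R) r^-1 x 1 1 (is_derive_id _ _).
    by rewrite /GRing.scale /= mulr1.
  exact: (@is_derive1_comp R G (fun t : R => t / r) x (f (x / r)) r^-1).
- by rewrite /= -mulNr !mulfK // gt_eqF.
Qed.

Lemma Rintegral_shift M f (h : R) : compsupp M f ->
  Rintegral lebesgue_measure setT (fun t => f (t + h)) =
  Rintegral lebesgue_measure setT f.
Proof.
move=> cf; have [K K0 HK] := compsupp_ex cf.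
pose N := Num.max K M; have KN : K <= N by rewrite le_max lexx.
have [G [dG ->]] := HK _ KN.
have N0 : 0 < N by lra.
apply: etrans; first apply: (@Rintegral_FTC _ (fun t => G (t + h)) (- N - h) (N - h)).
- by lra.
- move=> x.
  have c1 : {for x, continuous (fun t : R => t + h)}.
    by apply: cvgD; [exact: cvg_id|exact: cvg_cst].
  exact: (continuous_comp c1 (cf.1 _)).
- move=> x xN; apply: cf.2; rewrite ltNge; apply: contra xN.
  rewrite ler_norml => /andP[h1 h2].
  have MN : M <= N by rewrite le_max lexx orbT.
  by apply/andP; split; lra.
- move=> x xK.
  have xr : - N <= x + h <= N by move: xK => /andP[]; lra.
  have dGx := dG _ xr.
  have dr : is_derive x 1 (fun t : R => t + h) 1.
    exact: is_derive_shift.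
  have := @is_derive1_comp R G (fun t : R => t + h) x (f (x + h)) 1 dGx dr.
  by rewrite mulr1.
- by rewrite /= !subrK.
Qed.

End RealLineIntegral.

(** * Iterated integrals: bound, linearity and continuity of slices *)

Section IteratedIntegral.
Context {R : realType}.
Local Notation I := (Rintegral (@lebesgue_measure R) setT).

(** Spelled as the row in the body of [iint], so that peeling off one integration, [iintS], is a
    conversion. *)
Definition cons_mx n (t : R) (v : 'rV[R]_n) : 'rV[R]_n.+1 :=
  row_mx (const_mx t : 'rV[R]_1) v.

Lemma cons_mx0 n (t : R) (v : 'rV[R]_n) : cons_mx t v 0 ord0 = t.
Proof.
transitivity ((row_mx (const_mx t : 'rV[R]_1) v : 'rV[R]_(1 + n)) 0 (lshift n ord0)).
  by congr (fun_of_matrix _ _ _); apply/val_inj.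
by rewrite row_mxEl mxE.
Qed.

Lemma cons_mxS n (t : R) (v : 'rV[R]_n) (j : 'I_n) : cons_mx t v 0 (lift ord0 j) = v 0 j.
Proof.
transitivity ((row_mx (const_mx t : 'rV[R]_1) v : 'rV[R]_(1 + n)) 0 (rshift 1 j)).
  by congr (fun_of_matrix _ _ _); apply/val_inj.
by rewrite row_mxEr.
Qed.

Lemma rV_eq n (x y : 'rV[R]_n) : (forall j, x 0 j = y 0 j) -> x = y.
Proof. by move=> H; apply/rowP. Qed.

Lemma ord_split n (j : 'I_n.+1) : j = ord0 \/ exists j', j = lift ord0 j'.
Proof. by case: (unliftP ord0 j) => [j' ->|->]; [right; exists j'|left]. Qed.

Lemma shift_coord n (x : 'rV[R]_n) (h : R) (i j : 'I_n) :
  (x + h *: delta_mx 0 i) 0 j = x 0 j + h * (j == i)%:R.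
Proof. by rewrite !mxE. Qed.

Lemma cons_mx_delta0 n (t h : R) (v : 'rV[R]_n) :
  cons_mx t v + h *: delta_mx 0 ord0 = cons_mx (t + h) v.
Proof.
apply: rV_eq => j; rewrite shift_coord.
have [->|[j' ->]] := ord_split j; first by rewrite !cons_mx0 !eqxx mulr1.
by rewrite !cons_mxS /= mulr0 addr0.
Qed.

Lemma cons_mx_deltaS n (t h : R) (v : 'rV[R]_n) (i : 'I_n) :
  cons_mx t v + h *: delta_mx 0 (lift ord0 i) = cons_mx t (v + h *: delta_mx 0 i).
Proof.
apply: rV_eq => j; rewrite shift_coord.
have [->|[j' ->]] := ord_split j; first by rewrite !cons_mx0 /= mulr0 addr0.
by rewrite !cons_mxS shift_coord (inj_eq lift_inj).
Qed.

Lemma cons_mx_surj n (x : 'rV[R]_n.+1) : exists t v, x = cons_mx t v.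
Proof.
exists (x 0 ord0), (\row_j x 0 (lift ord0 j)); apply: rV_eq => j.
by have [->|[j' ->]] := ord_split j; rewrite ?cons_mx0 ?cons_mxS ?mxE.
Qed.

(** Continuity is asked uniformly because a slice then inherits the same modulus, and neighbouring
    slices are uniformly close; this makes the inner integral continuous in the outer variable. *)
Definition unifcompsupp n (M : R) (f : 'rV[R]_n -> R) :=
  (forall e, 0 < e -> exists2 d, 0 < d & forall x y : 'rV[R]_n,
      (forall j, `|x 0 j - y 0 j| < d) -> `|f x - f y| < e) /\
  (forall (x : 'rV[R]_n) j, M < `|x 0 j| -> f x = 0).

Definition slice n (f : 'rV[R]_n.+1 -> R) (t : R) (v : 'rV[R]_n) := f (cons_mx t v).

Lemma iintS n (f : 'rV[R]_n.+1 -> R) : iint f = I (fun t => iint (slice f t)).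
Proof. by []. Qed.

Lemma unifcompsupp_slice n M (f : 'rV[R]_n.+1 -> R) t :
  unifcompsupp M f -> unifcompsupp M (slice f t).
Proof.
case=> uf f0; split=> [e e0|x j xj]; last by apply: (f0 _ (lift ord0 j)); rewrite cons_mxS.
have [d d0 H] := uf e e0; exists d => // x y xy; apply: H => j.
by have [->|[j' ->]] := ord_split j; rewrite ?cons_mx0 ?cons_mxS ?subrr ?normr0.
Qed.

Lemma unifcompsuppW n M N (f : 'rV[R]_n -> R) :
  M <= N -> unifcompsupp M f -> unifcompsupp N f.
Proof.
by move=> MN [uf f0]; split=> // x j Nx; apply: (f0 x j); apply: le_lt_trans Nx.
Qed.

Lemma unifcompsupp_lin n M N (f g : 'rV[R]_n -> R) (c : R) :
  unifcompsupp M f -> unifcompsupp N g ->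
  unifcompsupp (Num.max M N) (fun x => c * f x + g x).
Proof.
case=> uf f0 [ug g0]; split=> [e e0|x j]; last first.
  by rewrite gt_max => /andP[Mx Nx]; rewrite (f0 x j) // (g0 x j) // mulr0 addr0.
have c0 : 0 < `|c| + 1 by rewrite ltr_wpDl.
have [d1 d10 H1] := uf (e / 2 / (`|c| + 1)) ltac:(by rewrite !divr_gt0).
have [d2 d20 H2] := ug (e / 2) ltac:(by rewrite divr_gt0).
exists (Num.min d1 d2); first by rewrite lt_min d10.
move=> x y xy.
have {}H1 := H1 x y ltac:(by move=> j; apply: lt_le_trans (xy j) _; rewrite ge_min lexx).
have {}H2 := H2 x y ltac:(by move=> j; apply: lt_le_trans (xy j) _; rewrite ge_min lexx orbT).
have -> : c * f x + g x - (c * f y + g y) = c * (f x - f y) + (g x - g y) by ring.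
apply: le_lt_trans (ler_normD _ _) _; rewrite normrM [e]splitr.
apply: ler_ltD => //; rewrite ltr_pdivlMr // in H1; apply: ltW; apply: le_lt_trans H1.
by rewrite mulrC ler_wpM2l // lerDl.
Qed.

Lemma slice_close n M (f : 'rV[R]_n.+1 -> R) (e : R) : unifcompsupp M f -> 0 < e ->
  exists2 d, 0 < d & forall t s : R, `|t - s| < d -> forall v, `|slice f t v - slice f s v| <= e.
Proof.
move=> [uf _] e0; have [d d0 H] := uf _ e0; exists d => // t s ts v.
apply: ltW; apply: H => j.
by have [->|[j' ->]] := ord_split j; rewrite ?cons_mx0 // !cons_mxS subrr normr0.
Qed.

(** The three claims need one another: continuity of the slice integrals in dimension [n] follows
    from the bound and linearity applied to a difference of slices, and it is what lets the
    one-dimensional bound and linearity act in dimension [n + 1]. *)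
Lemma iint_bounded_linear n :
  [/\ forall (M C : R) (f : 'rV[R]_n -> R), 0 <= M -> 0 <= C -> unifcompsupp M f ->
        (forall x, `|f x| <= C) -> `|iint f| <= C * (2 * (M + 1)) ^+ n,
      forall (M N : R) (f g : 'rV[R]_n -> R) (c : R),
        unifcompsupp M f -> unifcompsupp N g ->
        iint (fun x => c * f x + g x) = c * iint f + iint g &
      forall (M : R) (f : 'rV[R]_n.+1 -> R), 0 <= M -> unifcompsupp M f ->
        compsupp M (fun t => iint (slice f t))].
Proof.
have slices m :
    (forall (M C : R) (f : 'rV[R]_m -> R), 0 <= M -> 0 <= C -> unifcompsupp M f ->
      (forall x, `|f x| <= C) -> `|iint f| <= C * (2 * (M + 1)) ^+ m) ->
    (forall (M N : R) (f g : 'rV[R]_m -> R) (c : R), unifcompsupp M f ->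
      unifcompsupp N g -> iint (fun x => c * f x + g x) = c * iint f + iint g) ->
    forall (M : R) (f : 'rV[R]_m.+1 -> R), 0 <= M -> unifcompsupp M f ->
      compsupp M (fun t => iint (slice f t)).
  move=> bnd lin M f M0 uf; have us t := unifcompsupp_slice t uf; split; last first.
    move=> t Mt; have := bnd M 0 (slice f t) M0 (lexx _) (us t).
    rewrite mul0r normr_le0 => H; apply/eqP; apply: H => v.
    by rewrite normr_le0 /slice (uf.2 _ ord0) // cons_mx0.
  move=> t; apply/cvgrPdist_lt => e e0.
  have K0 : 0 < (2 * (M + 1)) ^+ m :> R by rewrite exprn_gt0 // mulr_gt0 // ltr_wpDl.
  pose e' := e / 2 / (2 * (M + 1)) ^+ m.
  have e'0 : 0 < e' by rewrite !divr_gt0.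
  have [d d0 H] := slice_close uf e'0.
  rewrite -nbhs_nearE; apply/nbhs_ballP; exists d => //= s.
  rewrite /ball /= => ts.
  have -> : iint (slice f t) - iint (slice f s) =
      iint (fun v => (-1) * slice f s v + slice f t v).
    by rewrite (lin _ _ _ _ (-1) (us s) (us t)) mulN1r addrC.
  apply: (@le_lt_trans _ _ (e' * (2 * (M + 1)) ^+ m)).
    apply: bnd => //; first exact: ltW.
      by rewrite -[X in unifcompsupp X](maxxx M); apply: unifcompsupp_lin.
    by move=> v; rewrite mulN1r addrC; apply: H.
  by rewrite /e' divfK ?gt_eqF //; lra.
elim: n => [|n [IHb IHl IHs]].
  have b0 : forall (M C : R) (f : 'rV[R]_0 -> R), 0 <= M -> 0 <= C -> unifcompsupp M f ->
      (forall x, `|f x| <= C) -> `|iint f| <= C * (2 * (M + 1)) ^+ 0.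
    by move=> M C f M0 C0 _ /(_ 0); rewrite /= expr0 mulr1.
  by split=> // M f; apply: (slices 0%N b0).
have IHb' (M C : R) (f : 'rV[R]_n.+1 -> R) : 0 <= M -> 0 <= C -> unifcompsupp M f ->
    (forall x, `|f x| <= C) -> `|iint f| <= C * (2 * (M + 1)) ^+ n.+1.
  move=> M0 C0 uf fC; rewrite iintS exprSr mulrA.
  apply: normr_Rintegral_le => //.
  - by rewrite mulr_ge0 // exprn_ge0 // mulr_ge0 // ltW // ltr_wpDl.
  - exact: IHs.
  - by move=> t; apply: IHb => // [|v]; [exact: unifcompsupp_slice|exact: fC].
have IHl' (M N : R) (f g : 'rV[R]_n.+1 -> R) (c : R) : unifcompsupp M f ->
    unifcompsupp N g -> iint (fun x => c * f x + g x) = c * iint f + iint g.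
  move=> uf ug; rewrite !iintS.
  (* [M] and [N] may be negative, whereas the claim on slices asks for a nonnegative bound. *)
  pose P := Num.max `|M| `|N|.
  have P0 : 0 <= P by rewrite le_max normr_ge0.
  have uf' : unifcompsupp P f by apply: unifcompsuppW uf; rewrite le_max ler_norm.
  have ug' : unifcompsupp P g by apply: unifcompsuppW ug; rewrite le_max ler_norm orbT.
  rewrite -(Rintegral_lin c (IHs P f P0 uf') (IHs P g P0 ug')).
  congr (Rintegral _ _ _); apply/funext => t.
  by rewrite -(IHl P P) //; apply: unifcompsupp_slice.
split; [exact: IHb'|exact: IHl'|exact: (slices _ IHb' IHl')].
Qed.

End IteratedIntegral.

(** * Iterated integrals: monotonicity, translation, integrals of partial derivatives *)

Section IteratedIntegralTheory.
Context {R : realType}.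
Local Notation I := (Rintegral (@lebesgue_measure R) setT).

Lemma eq_iint n (f g : 'rV[R]_n -> R) : f =1 g -> iint f = iint g.
Proof. by move=> fg; congr iint; apply/funext. Qed.

Lemma iint_lin n M N (f g : 'rV[R]_n -> R) (c : R) :
  unifcompsupp M f -> unifcompsupp N g ->
  iint (fun x => c * f x + g x) = c * iint f + iint g.
Proof. by have [_ + _] := @iint_bounded_linear R n; apply. Qed.

Lemma normr_iint_le n (M C : R) (f : 'rV[R]_n -> R) : 0 <= M -> 0 <= C ->
  unifcompsupp M f -> (forall x, `|f x| <= C) -> `|iint f| <= C * (2 * (M + 1)) ^+ n.
Proof. by have [+ _ _] := @iint_bounded_linear R n; apply. Qed.

Lemma unifcompsupp0 n M : unifcompsupp M (fun _ : 'rV[R]_n => 0).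
Proof. by split=> // e e0; exists 1 => // x y _; rewrite subrr normr0. Qed.

Lemma iint0 n : iint (fun _ : 'rV[R]_n => 0) = 0.
Proof.
have u := @unifcompsupp0 n 0.
have E : iint (fun _ : 'rV[R]_n => 0) = (-1) * iint (fun _ : 'rV[R]_n => 0) +
    iint (fun _ : 'rV[R]_n => 0).
  by rewrite -(iint_lin (-1) u u); apply: eq_iint => x; rewrite mulr0 addr0.
by rewrite E mulN1r addNr.
Qed.

Lemma unifcompsuppD n M (f g : 'rV[R]_n -> R) : unifcompsupp M f -> unifcompsupp M g ->
  unifcompsupp M (fun x => f x + g x).
Proof.
move=> uf ug; rewrite -(maxxx M).
have -> : (fun x => f x + g x) = (fun x => 1 * f x + g x).
  by apply/funext => x; rewrite mul1r.
exact: unifcompsupp_lin.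
Qed.

Lemma unifcompsuppZ n M (f : 'rV[R]_n -> R) (c : R) : unifcompsupp M f ->
  unifcompsupp M (fun x => c * f x).
Proof.
move=> uf; rewrite -(maxxx M).
have -> : (fun x => c * f x) = (fun x => c * f x + 0).
  by apply/funext => x; rewrite addr0.
by apply: unifcompsupp_lin => //; apply: unifcompsupp0.
Qed.

Lemma unifcompsupp_sum n (T : Type) (r : seq T) (P : pred T) M (f : T -> 'rV[R]_n -> R) :
  (forall i, P i -> unifcompsupp M (f i)) ->
  unifcompsupp M (fun x => \sum_(i <- r | P i) f i x).
Proof.
move=> uf; elim: r => [|i r IH].
  have -> : (fun x : 'rV[R]_n => \sum_(i <- [::] | P i) f i x) = fun=> 0.
    by apply/funext => x; rewrite big_nil.
  exact: unifcompsupp0.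
have [Pi|Pi] := boolP (P i); last first.
  suff -> : (fun x => \sum_(j <- i :: r | P j) f j x) =
    (fun x => \sum_(j <- r | P j) f j x) by [].
  by apply/funext => x; rewrite big_cons (negbTE Pi).
suff -> : (fun x => \sum_(j <- i :: r | P j) f j x) =
    (fun x => f i x + \sum_(j <- r | P j) f j x).
  by apply: unifcompsuppD => //; apply: uf.
by apply/funext => x; rewrite big_cons Pi.
Qed.

Lemma iintD n M (f g : 'rV[R]_n -> R) : unifcompsupp M f -> unifcompsupp M g ->
  iint (fun x => f x + g x) = iint f + iint g.
Proof.
move=> uf ug; rewrite -[X in X + _]mul1r -(iint_lin 1 uf ug).
by apply: eq_iint => x; rewrite mul1r.
Qed.

Lemma iintZ n M (f : 'rV[R]_n -> R) (c : R) : unifcompsupp M f ->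
  iint (fun x => c * f x) = c * iint f.
Proof.
move=> uf; rewrite -[RHS]addr0 -(iint0 n) -(iint_lin c uf (@unifcompsupp0 n 0)).
by apply: eq_iint => x; rewrite addr0.
Qed.

Lemma iint_sum n (T : Type) (r : seq T) (P : pred T) M (f : T -> 'rV[R]_n -> R) :
  (forall i, P i -> unifcompsupp M (f i)) ->
  iint (fun x => \sum_(i <- r | P i) f i x) = \sum_(i <- r | P i) iint (f i).
Proof.
move=> uf; elim: r => [|i r IH].
  by rewrite big_nil -[RHS](iint0 n); apply: eq_iint => x; rewrite big_nil.
rewrite big_cons; case: ifPn => Pi; rewrite -IH; last first.
  by apply: eq_iint => x; rewrite big_cons (negbTE Pi).
rewrite -(iintD (uf i Pi)); last exact: unifcompsupp_sum.
by apply: eq_iint => x; rewrite big_cons Pi.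
Qed.

Lemma compsupp_iint_slice n M (f : 'rV[R]_n.+1 -> R) : 0 <= M -> unifcompsupp M f ->
  compsupp M (fun t => iint (slice f t)).
Proof. by have [_ _ +] := @iint_bounded_linear R n; apply. Qed.

Lemma iint_le n M (f g : 'rV[R]_n -> R) : 0 <= M ->
  unifcompsupp M f -> unifcompsupp M g -> (forall x, f x <= g x) -> iint f <= iint g.
Proof.
move=> M0; elim: n f g => [|n IH] f g uf ug fg; first exact: fg.
rewrite !iintS; apply: (Rintegral_le (M := M) (N := M)).
- exact: compsupp_iint_slice.
- exact: compsupp_iint_slice.
- move=> t; apply: IH => [||v]; last exact: fg.
  + exact: unifcompsupp_slice.
  + exact: unifcompsupp_slice.
Qed.

Lemma iint_ge0 n M (f : 'rV[R]_n -> R) : 0 <= M -> unifcompsupp M f ->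
  (forall x, 0 <= f x) -> 0 <= iint f.
Proof.
move=> M0 uf f0; rewrite -(iint0 n); apply: (iint_le M0) => //.
exact: unifcompsupp0.
Qed.

Lemma iint_gt0 n M (f : 'rV[R]_n -> R) (x : 'rV[R]_n) : 0 <= M -> unifcompsupp M f ->
  (forall x, 0 <= f x) -> 0 < f x -> 0 < iint f.
Proof.
move=> M0; elim: n f x => [|n IH] f x uf f0 fx.
  have x0 : x = 0 by apply: rV_eq => -[].
  by rewrite x0 in fx.
have [t [v xE]] := cons_mx_surj x; rewrite xE in fx.
rewrite iintS; apply: (@Rintegral_gt0 R M _ t).
- exact: compsupp_iint_slice.
- move=> s; apply: (iint_ge0 M0) => [|w]; last exact: f0.
  exact: unifcompsupp_slice.
- apply: (IH _ v) => [|w|]; [|exact: f0|exact: fx].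
  exact: unifcompsupp_slice.
Qed.

Lemma iint_shift n M (f : 'rV[R]_n -> R) (i : 'I_n) (h : R) : 0 <= M ->
  unifcompsupp M f -> iint (fun x => f (x + h *: delta_mx 0 i)) = iint f.
Proof.
move=> M0; elim: n f i => [f [] //|n IH] f i uf.
have [->|[i' ->]] := ord_split i.
  rewrite !iintS -(Rintegral_shift h (compsupp_iint_slice M0 uf)).
  congr (Rintegral _ _ _); apply/funext => t; apply: eq_iint => v.
  by rewrite /slice cons_mx_delta0.
rewrite !iintS; congr (Rintegral _ _ _); apply/funext => t.
rewrite -(IH (slice f t) i'); last exact: unifcompsupp_slice.
by apply: eq_iint => v; rewrite /slice cons_mx_deltaS.
Qed.

Lemma unifcompsupp_shift n M (f : 'rV[R]_n -> R) (i : 'I_n) (h : R) :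
  unifcompsupp M f -> unifcompsupp (M + `|h|) (fun x => f (x + h *: delta_mx 0 i)).
Proof.
case=> uf f0; split=> [e e0|x j xj].
  have [d d0 H] := uf e e0; exists d => // x y xy; apply: H => j.
  rewrite !shift_coord; have := xy j; congr (`|_| < _); ring.
apply: (f0 _ j); rewrite shift_coord -ltrBDr in xj *.
apply: lt_le_trans xj _; rewrite lerBlDr.
have := ler_normB (x 0 j + h * (j == i)%:R) (h * (j == i)%:R).
rewrite addrK => /le_trans; apply; rewrite lerD2l normrM ler_piMr //.
by case: (j == i); rewrite ?normr1 ?normr0.
Qed.

Lemma derivable_line (V : normedModType R) (f : V -> R) (x v : V) (t : R) :
  derivable f (x + t *: v) v ->
  is_derive t 1 (fun s : R => f (x + s *: v)) ('D_v f (x + t *: v)).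
Proof.
move=> df.
have E : (fun h => h^-1 *: (f (h *: v + (x + t *: v)) - f (x + t *: v))) =
  (fun h : R => h^-1 *: (f (x + (h *: (1 : R) + t) *: v) - f (x + t *: v))).
  apply/funext => h; congr (_ *: (f _ - _)).
  by rewrite scalerDl [(h *: 1)%R]mulr1 addrCA.
apply: DeriveDef; first by move: df; rewrite /derivable E.
by rewrite /derive -E.
Qed.

Lemma partial_line n (f : 'rV[R]_n -> R) (x : 'rV[R]_n) (i : 'I_n) (h : R) :
  (forall x, derivable f x (delta_mx 0 i)) -> h != 0 ->
  exists2 c, `|c| <= `|h| &
    f (x + h *: delta_mx 0 i) - f x = partial i f (x + c *: delta_mx 0 i) * h.
Proof.
move=> df h0.
pose g s := f (x + s *: delta_mx 0 i).
pose g' s := partial i f (x + s *: delta_mx 0 i).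
have dg (s : R) : is_derive s 1 g (g' s) by apply: derivable_line; apply: df.
have E0 : f x = g 0 by rewrite /g scale0r addr0.
have [h1|h1] := ltrP 0 h.
  have [c /andP[c0 ch] E] := mvt_closed h1 (fun s _ => dg s).
  by exists c; [rewrite !ger0_norm // ltW|rewrite E0 E subr0].
have {}h1 : h < 0 by rewrite lt_neqAle h0.
have [c /andP[c0 ch] E] := mvt_closed h1 (fun s _ => dg s).
exists c; first by rewrite !ler0_norm ?lerN2 // ltW.
by rewrite E0 -opprB E sub0r mulrN opprK.
Qed.

(* Difference quotients integrate to 0 by translation invariance and converge
   uniformly to the partial derivative. *)
Lemma iint_partial n M (f : 'rV[R]_n -> R) (i : 'I_n) : 0 <= M ->
  unifcompsupp M f -> (forall x, derivable f x (delta_mx 0 i)) ->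
  unifcompsupp M (partial i f) -> iint (partial i f) = 0.
Proof.
move=> M0 uf df up; apply/eqP; rewrite -normr_le0; apply/ler_addgt0Pl => e e0.
rewrite addr0.
have K0 : 0 < (2 * (M + 1 + 1)) ^+ n :> R.
  by rewrite exprn_gt0 // mulr_gt0 // addr_gt0 // ltr_wpDl.
pose e' := e / (2 * (M + 1 + 1)) ^+ n.
have e'0 : 0 < e' by rewrite divr_gt0.
have [d d0 H] := up.1 _ e'0.
(* Less than [d] for the uniform estimate, and at most 1 so that the translate keeps its support in
   the box of size [M + 1]. *)
pose h := Num.min (d / 2) 1.
have h0 : 0 < h by rewrite lt_min divr_gt0 //=.
have h1 : h <= 1 by rewrite ge_min lexx orbT.
have hd : h < d by rewrite gt_min; apply/orP; left; lra.
pose q x := h^-1 * f (x + h *: delta_mx 0 i) + (- h^-1) * f x.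
have us : unifcompsupp (M + 1) (fun x => f (x + h *: delta_mx 0 i)).
  by apply: unifcompsuppW (unifcompsupp_shift i h uf); rewrite lerD2l gtr0_norm.
have W (g : 'rV[R]_n -> R) : unifcompsupp M g -> unifcompsupp (M + 1) g.
  by apply: unifcompsuppW; rewrite lerDl.
have uq : unifcompsupp (M + 1) q.
  by apply: unifcompsuppD; apply: unifcompsuppZ => //; apply: W.
have q0 : iint q = 0.
  rewrite (iint_lin _ us (unifcompsuppZ _ (W _ uf))) (iintZ _ uf) (iint_shift _ _ M0 uf).
  by rewrite mulNr subrr.
have -> : iint (partial i f) = iint (fun x => (-1) * q x + partial i f x).
  by rewrite (iint_lin _ uq up) q0 mulr0 add0r.
apply: (@le_trans _ _ (e' * (2 * (M + 1 + 1)) ^+ n)); last first.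
  by rewrite divfK // gt_eqF.
apply: normr_iint_le.
- by rewrite addr_ge0.
- exact: ltW.
- by apply: unifcompsuppD; [exact: unifcompsuppZ|exact: W].
move=> x; have [c ch E] := partial_line x df (lt0r_neq0 h0).
have -> : q x = partial i f (x + c *: delta_mx 0 i).
  by rewrite /q mulNr -mulrBr E mulrC mulfK // gt_eqF.
rewrite mulN1r addrC; apply: ltW; apply: H => j.
rewrite shift_coord opprD addrA subrr sub0r normrN normrM.
apply: le_lt_trans hd; rewrite -(gtr0_norm h0); apply: le_trans ch.
by rewrite ler_piMr //; case: (j == i); rewrite ?normr1 ?normr0.
Qed.

(** Heine-Cantor on a box with margin 1 around the support. Since the final distance is at most 1, a
    point outside this box forces its neighbours off the support too. *)
Lemma continuous_unifcompsupp n M (f : 'rV[R]_n -> R) : continuous f ->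
  (forall (x : 'rV[R]_n) j, M < `|x 0 j| -> f x = 0) -> unifcompsupp M f.
Proof.
move=> cf f0; split=> // e e0.
have Kc : compact [set v : 'rV[R]_n | forall i, v ord0 i \in `[- (M + 1), M + 1]].
  by apply: (@rV_compact _ _ (fun=> `[- (M + 1), M + 1]%classic)) => _;
     exact: segment_compact.
have cov : \forall d \near (0 : R)^'+,
    [set v : 'rV[R]_n | forall i, v ord0 i \in `[- (M + 1), M + 1]] `<=`
    (fun x => forall y : 'rV[R]_n, (forall j, `|x 0 j - y 0 j| < d) -> `|f x - f y| < e).
  move/compact_near_coveringP: Kc; apply.
  move=> x _.
  have /cvgrPdist_lt /(_ (e / 2) ltac:(by rewrite divr_gt0)) := cf x.
  rewrite -nbhs_nearE => /nbhs_ballP[d /= d0 Hd].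
  exists (ball x (d / 2), [set s | s < d / 2]).
    split => /=; first by apply: nbhsx_ballx; rewrite divr_gt0.
    by apply: nbhs_right_lt; rewrite divr_gt0.
  move=> [x' s] /= [[_ xx'] sd] y x'y.
  have /Hd h1 : ball x d x'.
    split=> // a b; apply: le_ball (xx' a b); lra.
  have /Hd h2 : ball x d y.
    split=> // a b; rewrite (ord1 a).
    have := xx' 0 b; rewrite /ball /= => h2; have h3 := x'y b.
    rewrite -(subrKA (x' 0 b)); apply: le_lt_trans (ler_normD _ _) _.
    by rewrite [d]splitr ltrD // (lt_trans h3).
  have -> : f x' - f y = (f x - f y) - (f x - f x') by ring.
  by apply: le_lt_trans (ler_normB _ _) _; rewrite [e]splitr ltrD.
have [d [Hd /= d0]] := filter_ex (filterI cov (nbhs_right_gt (0 : R))).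
exists (Num.min d 1); first by rewrite lt_min d0 ltr01.
move=> x y xy.
have [xK|] := pselect (forall i, x ord0 i \in `[- (M + 1), M + 1]).
  by apply: Hd => // j; apply: lt_le_trans (xy j) _; rewrite ge_min lexx.
move/existsNP => [j /negP]; rewrite in_itv /= -ler_norml -ltNge => xj.
have yj : M < `|y 0 j|.
  have := xy j; rewrite lt_min => /andP[_]; have := ler_normD (x 0 j - y 0 j) (y 0 j).
  by rewrite subrK; lra.
by rewrite (f0 x j) ?(f0 y j) ?subrr ?normr0 //; lra.
Qed.

End IteratedIntegralTheory.

(** * The substitution s_j = x_j / rho_j in iterated integrals *)

Section TriangularSubstitution.
Context {R : realType}.
Local Notation I := (Rintegral (@lebesgue_measure R) setT).

Lemma compsupp0 (M : R) : compsupp M (fun=> 0 : R).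
Proof. by split => // x; apply: cvg_cst. Qed.

Lemma compsuppZ (M c : R) f : compsupp M f -> compsupp M (fun x => c * f x).
Proof.
case=> cf f0; split=> [x|x Mx]; last by rewrite f0 // mulr0.
by apply: cvgM; [exact: cvg_cst|exact: cf].
Qed.

Lemma Rintegral0 : I (fun=> 0) = 0.
Proof.
have u := @compsupp0 0.
have E : I (fun=> 0) = (-1) * I (fun=> 0) + I (fun=> 0).
  rewrite -(Rintegral_lin (-1) u u); congr (Rintegral _ _ _); apply/funext => x.
  by rewrite mulr0 addr0.
by rewrite E mulN1r addNr.
Qed.

Lemma RintegralZ (M c : R) f : compsupp M f -> I (fun x => c * f x) = c * I f.
Proof.
move=> cf; have := Rintegral_lin c cf (compsupp0 0); rewrite Rintegral0 addr0 => <-.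
by congr (Rintegral _ _ _); apply/funext => x; rewrite addr0.
Qed.

(** The Jacobian matrix is triangular: [rho j] is frozen by the outer variables when the [j]-th
    integral is taken, so a scaling of the line removes it. By induction the inner integrals do not
    depend on the outer variable, and [rho ord0] is a constant. *)
Lemma iint_triangular n (rho : 'I_n -> 'rV[R]_n -> R) (B : 'I_n -> R -> R)
    (M : 'I_n -> R) (c : R) :
  (forall j x, 0 < rho j x) ->
  (forall (j : 'I_n) (x y : 'rV[R]_n), (forall l : 'I_n, (l < j)%N -> x 0 l = y 0 l) ->
    rho j x = rho j y) ->
  (forall j, compsupp (M j) (B j)) ->
  iint (fun x => c * \prod_j (B j (x 0 j / rho j x) / rho j x)) = c * \prod_j I (B j).
Proof.
elim: n rho B M c => [|n IH] rho B M c r0 rl cB; first by rewrite /= !big_ord0.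
rewrite iintS.
pose P := c * \prod_j I (B (lift ord0 j)).
have r0E x : rho ord0 x = rho ord0 0 by apply: rl.
have E t : iint (slice (fun x => c * \prod_j (B j (x 0 j / rho j x) / rho j x)) t) =
    (P * B ord0 (t / rho ord0 0)) / rho ord0 0.
  transitivity (c * (B ord0 (t / rho ord0 0) / rho ord0 0) * \prod_j I (B (lift ord0 j))).
    rewrite -(IH (fun j v => rho (lift ord0 j) (cons_mx t v)) (fun j => B (lift ord0 j))
      (fun j => M (lift ord0 j))) //; last first.
      move=> j x y xy; apply: rl => l; have [->|[l' ->]] := ord_split l.
        by rewrite !cons_mx0.
      by rewrite !cons_mxS => lj; apply: xy.
    apply: eq_iint => v; rewrite /slice big_ord_recl cons_mx0 r0E mulrA.
    by congr (_ * _); apply: eq_bigr => j _; rewrite cons_mxS.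
  by rewrite /P; ring.
under eq_fun do rewrite E.
rewrite (Rintegral_scale (r0 _ _) (compsuppZ P (cB ord0))) (RintegralZ _ (cB ord0)).
by rewrite big_ord_recl /P; ring.
Qed.

End TriangularSubstitution.

(** * Directional derivatives and the chain rule *)

Section ChainRule.
Context {R : realType} {V : normedModType R}.

Lemma is_derive_line (f : V -> R) (x v : V) (d : R) :
  is_derive x v f d <-> is_derive (0 : R) 1 (fun h : R => f (h *: v + x)) d.
Proof.
have E : 'D_v f x = 'D_1 (fun h : R => f (h *: v + x)) 0.
  rewrite /derive; set g1 := fun h => h^-1 *: _; set g2 := fun h => h^-1 *: _.
  suff -> : g1 = g2 by [].
  by apply/funext => h; rewrite /g1 /g2 /= addr0 scale0r add0r [_%:A]mulr1.
split=> -[df <-].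
  by rewrite E; exact: derivableP ((derivable1P f x v).1 df).
by rewrite -E; exact: derivableP ((derivable1P f x v).2 df).
Qed.

Lemma is_derive_comp_dir (g : R -> R) (f : V -> R) (x v : V) (a b : R) :
  is_derive (f x) 1 g a -> is_derive x v f b ->
  is_derive x v (fun y => g (f y)) (a * b).
Proof.
move=> dg /is_derive_line df; apply/is_derive_line.
have h0 : f x = (fun h : R => f (h *: v + x)) 0 by rewrite scale0r add0r.
rewrite h0 in dg.
exact: (@is_derive1_comp R g (fun h : R => f (h *: v + x)) 0 a b dg df).
Qed.

End ChainRule.

Lemma near_eq_continuous_at (T : topologicalType) (R : realType) (f g : T -> R) (x : T) :
  {near x, f =1 g} -> {for x, continuous f} -> {for x, continuous g}.
Proof.
move=> fg cf; rewrite /prop_for /continuous_at -(nbhs_singleton fg).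
by apply: cvg_trans cf; apply: near_eq_cvg; apply: filterS fg => y ->.
Qed.

Lemma continuous_atD (T : topologicalType) (R : realType) (f g : T -> R) (x : T) :
  {for x, continuous f} -> {for x, continuous g} ->
  {for x, continuous (fun y => f y + g y)}.
Proof. by move=> cf cg; apply: cvgD. Qed.

Lemma continuous_atM (T : topologicalType) (R : realType) (f g : T -> R) (x : T) :
  {for x, continuous f} -> {for x, continuous g} ->
  {for x, continuous (fun y => f y * g y)}.
Proof. by move=> cf cg; apply: cvgM. Qed.

(** * Functions with continuous iterated partial derivatives on a set *)

Section CkFunctions.
Context {R : realType} {n : nat}.
Implicit Types (U : set 'rV[R]_n) (f g : 'rV[R]_n -> R) (i : 'I_n).

(** Relative to [U], because the logarithms and inverses involved are regular on the half-space
    only. Built on [partial], so that validity on [setT] for all [m] yields [smooth]. *)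
Fixpoint Ck (m : nat) U f : Prop :=
  match m with
  | 0 => forall x, U x -> {for x, continuous f}
  | m'.+1 => (forall x, U x -> {for x, continuous f}) /\
      forall i, (forall x, U x -> derivable f x (delta_mx 0 i)) /\ Ck m' U (partial i f)
  end.

Lemma Ck_cont m U f x : Ck m U f -> U x -> {for x, continuous f}.
Proof. by case: m => [|m] /=; [exact|case=> + _]; apply. Qed.

Lemma Ck_derivable m U f i x : Ck m.+1 U f -> U x -> derivable f x (delta_mx 0 i).
Proof. by case=> _ /(_ i)[+ _]; apply. Qed.

Lemma Ck_partial m U f i : Ck m.+1 U f -> Ck m U (partial i f).
Proof. by case=> _ /(_ i)[]. Qed.

Lemma Ck_is_derive m U f i x : Ck m.+1 U f -> U x ->
  is_derive x (delta_mx 0 i) f (partial i f x).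
Proof. by move=> cf Ux; exact: derivableP (Ck_derivable (i := i) cf Ux). Qed.

Lemma CkS m U f : Ck m.+1 U f -> Ck m U f.
Proof.
elim: m f => [|m IH] f; first by case.
by case=> cf df; split=> // i; have [d1 d2] := df i; split=> //; apply: IH.
Qed.

Lemma open_eq_near U f g x : open U -> U x -> (forall y, U y -> f y = g y) ->
  {near x, f =1 g}.
Proof.
move=> oU Ux fg; rewrite /prop_near1.
suff: nbhs x U by apply: filterS => y; exact: fg.
by apply: open_nbhs_nbhs; split.
Qed.

Lemma eq_partial U f g i x : open U -> U x -> (forall y, U y -> f y = g y) ->
  partial i f x = partial i g x.
Proof. by move=> oU Ux fg; exact: near_eq_derive (open_eq_near oU Ux fg). Qed.

Lemma eq_Ck m U f g : open U -> (forall y, U y -> f y = g y) -> Ck m U f -> Ck m U g.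
Proof.
move=> oU; elim: m f g => [|m IH] f g fg.
  by move=> cf x Ux; exact: near_eq_continuous_at (open_eq_near oU Ux fg) (cf x Ux).
case=> cf df; split.
  by move=> x Ux; exact: near_eq_continuous_at (open_eq_near oU Ux fg) (cf x Ux).
move=> i; have [d1 d2] := df i; split.
  by move=> x Ux; exact: near_eq_derivable (open_eq_near oU Ux fg) (d1 x Ux).
apply: IH d2 => y Uy; exact: eq_partial Uy fg.
Qed.

(** Explicit candidates for the partial derivatives allow an induction on the order that never
    computes with [partial] itself. *)
Lemma CkSI m U f (f' : 'I_n -> 'rV[R]_n -> R) : open U ->
  (forall x, U x -> {for x, continuous f}) ->
  (forall i x, U x -> is_derive x (delta_mx 0 i) f (f' i x)) ->
  (forall i, Ck m U (f' i)) -> Ck m.+1 U f.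
Proof.
move=> oU cf df cf'; split=> // i; split=> [x Ux|]; first by have [] := df i x Ux.
apply: (eq_Ck oU) (cf' i) => y Uy.
by have [_ <-] := df i y Uy.
Qed.

Lemma Ck_cst m U (c : R) : open U -> Ck m U (fun=> c).
Proof.
move=> oU; elim: m c => [|m IH] c; first by move=> x _; exact: cst_continuous.
apply: (@CkSI _ _ _ (fun _ _ => 0)) => //; by move=> x _; exact: cst_continuous.
Qed.

Lemma CkD m U f g : open U -> Ck m U f -> Ck m U g -> Ck m U (fun x => f x + g x).
Proof.
move=> oU; elim: m f g => [|m IH] f g cf cg.
  by move=> x Ux; apply: continuous_atD; [exact: cf|exact: cg].
apply: (@CkSI _ _ _ (fun i x => partial i f x + partial i g x)) => //.
- by move=> x Ux; apply: continuous_atD; [exact: Ck_cont cf Ux|exact: Ck_cont cg Ux].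
- move=> i x Ux; have h1 := Ck_is_derive i cf Ux; have h2 := Ck_is_derive i cg Ux.
  exact: is_deriveD.
- by move=> i; apply: IH; apply: Ck_partial.
Qed.

Lemma CkM m U f g : open U -> Ck m U f -> Ck m U g -> Ck m U (fun x => f x * g x).
Proof.
move=> oU; elim: m f g => [|m IH] f g cf cg.
  by move=> x Ux; apply: continuous_atM; [exact: cf|exact: cg].
apply: (@CkSI _ _ _ (fun i x => f x * partial i g x + g x * partial i f x)) => //.
- by move=> x Ux; apply: continuous_atM; [exact: Ck_cont cf Ux|exact: Ck_cont cg Ux].
- move=> i x Ux; have h1 := Ck_is_derive i cf Ux; have h2 := Ck_is_derive i cg Ux.
  exact: is_deriveM.
- move=> i; apply: CkD => //; apply: IH; [exact: CkS|exact: Ck_partial|exact: CkS|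
    exact: Ck_partial].
Qed.

Lemma Ck_sum (T : Type) (r : seq T) (P : pred T) m U (F : T -> 'rV[R]_n -> R) : open U ->
  (forall t, P t -> Ck m U (F t)) -> Ck m U (fun x => \sum_(t <- r | P t) F t x).
Proof.
move=> oU cF; elim: r => [|t r IH].
  by under eq_fun do rewrite big_nil; exact: Ck_cst.
have [Pt|/negbTE Pt] := boolP (P t); under eq_fun do rewrite big_cons Pt; last exact: IH.
by apply: CkD => //; apply: cF.
Qed.

Lemma Ck_prod (T : Type) (r : seq T) (P : pred T) m U (F : T -> 'rV[R]_n -> R) : open U ->
  (forall t, P t -> Ck m U (F t)) -> Ck m U (fun x => \prod_(t <- r | P t) F t x).
Proof.
move=> oU cF; elim: r => [|t r IH].
  by under eq_fun do rewrite big_nil; exact: Ck_cst.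
have [Pt|/negbTE Pt] := boolP (P t); under eq_fun do rewrite big_cons Pt; last exact: IH.
by apply: CkM => //; apply: cF.
Qed.

Lemma is_derive_coord (j i : 'I_n) (x : 'rV[R]_n) :
  is_derive x (delta_mx 0 i) (fun y : 'rV[R]_n => y 0 j) (j == i)%:R.
Proof.
apply/is_derive_line.
have -> : (fun h : R => (h *: delta_mx 0 i + x) 0 j) =
    (fun h : R => ((j == i)%:R *: id) h + x 0 j).
  by apply/funext => h; rewrite !mxE /= /GRing.scale /= mulrC.
rewrite -[X in is_derive _ _ _ X]addr0.
apply: (@is_deriveD R R R ((j == i)%:R *: id) (cst (x 0 j))).
rewrite -[X in is_derive _ _ _ X]mulr1.
exact: (@is_deriveZ R R R id).
Qed.

Lemma Ck_coord m U (j : 'I_n) : open U -> Ck m U (fun x : 'rV[R]_n => x 0 j).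
Proof.
move=> oU; case: m => [x _|m]; first exact: coord_continuous.
apply: (@CkSI _ _ _ (fun i _ => (j == i)%:R)) => //.
- by move=> x _; exact: coord_continuous.
- by move=> i x _; exact: is_derive_coord.
- by move=> i; exact: Ck_cst.
Qed.

(* A family [S] of one-variable functions closed under differentiation on [D]
   preserves every class [Ck] by composition. *)
Lemma Ck_comp (D : set R) (S : (R -> R) -> Prop) m U f (g : R -> R) : open U ->
  (forall g : R -> R, S g ->
    exists2 g' : R -> R, S g' & forall y : R, D y -> is_derive y 1 g (g' y)) ->
  (forall x, U x -> D (f x)) -> S g -> Ck m U f -> Ck m U (fun x => g (f x)).
Proof.
move=> oU HS UD; elim: m g => [|m IH] g Sg cf; have [g' Sg' dg] := HS _ Sg;
  have cg y : D y -> {for y, continuous g} by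
    move=> Dy; have [+ _] := dg y Dy; move/derivable1_diffP/differentiable_continuous.
  by move=> x Ux; apply: (continuous_comp (cf x Ux)); apply/cg/UD.
apply: (@CkSI _ _ _ (fun i x => g' (f x) * partial i f x)) => //.
- move=> x Ux; apply: (continuous_comp (Ck_cont cf Ux)); exact/cg/UD.
- move=> i x Ux; apply: is_derive_comp_dir; first exact/dg/UD.
  exact: Ck_is_derive cf Ux.
- by move=> i; apply: CkM => //; [apply: IH => //; exact: CkS|exact: Ck_partial].
Qed.

Lemma Ck_expR m U f : open U -> Ck m U f -> Ck m U (fun x => expR (f x)).
Proof.
move=> oU; apply: (@Ck_comp setT (eq (@expR R))) => //.
by move=> _ <-; exists expR => // y _; exact: is_derive_expR.
Qed.

Lemma is_derive_inv (y : R) : y != 0 -> is_derive y 1 (fun z : R => z^-1) (- y^-1 ^+ 2).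
Proof.
move=> y0; have := @is_deriveV R id y 1 1 y0 (is_derive_id _ _).
by rewrite /GRing.scale /= mulr1 exprVn.
Qed.

Lemma Ck_ln m U f : open U -> (forall x, U x -> 0 < f x) -> Ck m U f ->
  Ck m U (fun x => ln (f x)).
Proof.
move=> oU fpos.
(* The derivatives of [ln] are multiples of negative powers; together with [ln] they form a family
   closed under differentiation. *)
apply: (@Ck_comp [set y | 0 < y]
  (fun g : R -> R => g = @ln R \/ exists (c : R) k, g = fun y => c * y^-1 ^+ k)) => //;
  last by left.
move=> _ [->|[c [k ->]]].
  exists (fun y => 1 * y^-1 ^+ 1); first by right; exists 1, 1%N.
  by move=> y y0; rewrite mul1r expr1; exact: is_derive1_ln.
exists (fun y => - c * k%:R * y^-1 ^+ k.+1); first by right; exists (- c * k%:R), k.+1.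
move=> y y0; have dV := is_derive_inv (lt0r_neq0 y0).
have := @is_deriveZ R R R _ c y 1 _ (is_deriveX k dV).
congr (is_derive _ _ _ _); first by apply/funext => z /=; rewrite exprfctE.
rewrite /GRing.scale /=; case: k => [|k]; first by rewrite !(mul0r, mulr0).
by rewrite /= !exprS; ring.
Qed.

Lemma Ck_inv m U f : open U -> (forall x, U x -> 0 < f x) -> Ck m U f ->
  Ck m U (fun x => (f x)^-1).
Proof.
move=> oU fpos cf; apply: (@eq_Ck _ _ (fun x => expR (-1 * ln (f x)))) => //.
  by move=> y Uy; rewrite mulN1r expRN lnK // posrE fpos.
by apply/Ck_expR/CkM => //; [exact: Ck_cst|exact: Ck_ln].
Qed.

Lemma CkU m U W f : Ck m U f -> Ck m W f -> Ck m (U `|` W) f.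
Proof.
elim: m f => [|m IH] f; first by move=> cU cW x [/cU|/cW].
move=> [cU dU] [cW dW]; split; first by move=> x [/cU|/cW].
move=> i; have [d1 d2] := dU i; have [e1 e2] := dW i; split; last exact: IH.
by move=> x [/d1|/e1].
Qed.

(** Regularity is local: [U] and the complement of [K] are open and cover the space, and on the
    latter the function is 0. *)
Lemma Ck_extend m U (K : set 'rV[R]_n) f : open U -> closed K -> K `<=` U ->
  (forall x, ~ K x -> f x = 0) -> Ck m U f -> Ck m setT f.
Proof.
move=> oU cK KU f0 cf.
have <- : U `|` ~` K = setT.
  by apply/seteqP; split=> // x _; have [/KU|] := pselect (K x); [left|right].
apply: CkU => //; have oK := closed_openC cK.
by apply: (eq_Ck oK) (@Ck_cst m _ 0 oK) => y /f0.
Qed.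

Lemma smooth_Ck f : (forall m, Ck m setT f) -> smooth f.
Proof.
move=> cf s; have {}cf m : Ck m setT (iter_partial s f).
  by elim: s m => //= i s IH m; apply: Ck_partial.
split; first by move=> x; exact: (cf 0%N).
by move=> i x; apply: (Ck_derivable (m := 0)).
Qed.

End CkFunctions.

(** * A smooth bump function *)

Section Bump.
Context {R : realType}.

(** The flat function exp(-1/y) extended by 0, times y^(-m). The powers are included because
    differentiation produces them. *)
Definition ebump (m : nat) (y : R) : R := if 0 < y then y^-1 ^+ m * expR (- y^-1) else 0.

Lemma ebump_ge0 m y : 0 <= ebump m y.
Proof.
rewrite /ebump; case: ifP => // y0; rewrite mulr_ge0 ?expR_ge0 // exprn_ge0 //.
by rewrite invr_ge0 ltW.
Qed.

Lemma ebump_gt0 m y : 0 < y -> 0 < ebump m y.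
Proof. by move=> y0; rewrite /ebump y0 mulr_gt0 ?expR_gt0 // exprn_gt0 // invr_gt0. Qed.

Lemma ebump_le0 m y : y <= 0 -> ebump m y = 0.
Proof. by move=> y0; rewrite /ebump ltNge y0. Qed.

(** One term of the exponential series, exp z >= z^(m+2) / (m+2)! at z = 1/y. The quadratic order
    gives derivative 0 at the origin. *)
Lemma ebump_quadratic m y : `|ebump m y| <= (m.+2)`!%:R * y ^+ 2.
Proof.
rewrite ger0_norm ?ebump_ge0 //; have [y0|y0] := ltrP 0 y; last first.
  by rewrite ebump_le0 // mulr_ge0 // sqr_ge0.
have z0 : 0 < y^-1 by rewrite invr_gt0.
have H := expR_ge1Dxn m.+1 (ltW z0).
rewrite /ebump y0 expRN ler_pdivrMr ?expR_gt0 //.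
have f0 : 0 < (m.+2)`!%:R :> R by rewrite ltr0n fact_gt0.
have y2 : 0 < y ^+ 2 by rewrite exprn_gt0.
apply: (@le_trans _ _ ((m.+2)`!%:R * y ^+ 2 * (y^-1 ^+ m.+2 / (m.+2)`!%:R))).
  rewrite le_eqVlt; apply/orP; left; apply/eqP; rewrite [y^-1 ^+ m.+2]exprS [y^-1 ^+ m.+1]exprS.
  move: (y^-1 ^+ m) ((m.+2)`!%:R) f0 => p F F0.
  by field; rewrite !gt_eqF.
apply: ler_wpM2l; first by rewrite mulr_ge0 // ltW.
by apply: le_trans H; rewrite lerDr.
Qed.

Lemma is_derive_quadratic (g : R -> R) (C : R) : (forall h, `|g h| <= C * h ^+ 2) ->
  is_derive (0 : R) 1 g 0.
Proof.
move=> gC; have g0 : g 0 = 0.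
  by apply/eqP; rewrite -normr_le0 (le_trans (gC 0)) // expr0n mulr0.
have C0 : 0 <= C by have := gC 1; rewrite expr1n mulr1; apply: le_trans.
have H : h^-1 *: (g (h *: (1 : R) + 0) - g 0) @[h --> (0 : R)^'] --> (0 : R).
  apply/cvgrPdist_lt => e e0; rewrite near_withinE -nbhs_nearE.
  apply/nbhs_ballP; exists (e / (C + 1)) => /=; first by rewrite divr_gt0 // ltr_wpDl.
  move=> h; rewrite /ball /= sub0r normrN => he h0.
  rewrite sub0r normrN g0 subr0 addr0 /GRing.scale /= mulr1 normrM normfV.
  rewrite mulrC ltr_pdivrMr ?normr_gt0 //; apply: le_lt_trans (gC h) _.
  rewrite -[h ^+ 2]real_normK ?num_real // expr2 mulrA ltr_pM2r ?normr_gt0 //.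
  rewrite ltr_pdivlMr ?ltr_wpDl // in he; apply: le_lt_trans he.
  by rewrite mulrC ler_wpM2l // lerDl.
apply: DeriveDef; first by apply/cvg_ex; exists 0.
exact/cvg_lim.
Qed.

Lemma is_derive_ebump m (y : R) : is_derive y 1 (ebump m) (ebump m.+2 y - m%:R * ebump m.+1 y).
Proof.
have [y0|y0|y0] := ltrgtP y 0.
- rewrite !ebump_le0 1?ltW // mulr0 subrr.
  apply: (near_eq_is_derive (f := (cst 0 : R -> R))).
  by near=> z; rewrite ebump_le0 // ltW //; near: z; exact: lt_nbhsl.
- apply: (near_eq_is_derive (f := (fun z => z^-1 ^+ m) * (fun z => expR (- z^-1)))).
    by near=> z; rewrite /ebump ifT //; near: z; exact: lt_nbhsr.
  have dV := is_derive_inv (lt0r_neq0 y0).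
  have dX := is_deriveX m dV; rewrite exprfctE in dX.
  have dE : is_derive y 1 (fun z : R => expR (- z^-1)) (expR (- y^-1) * - (- y^-1 ^+ 2)).
    apply: (@is_derive1_comp R expR (fun z => - z^-1) y).
  have := is_deriveM dX dE; congr (is_derive _ _ _ _).
  rewrite /ebump y0 /GRing.scale /=; case: m {dX} => [|m]; rewrite /= !exprS; ring.
- rewrite y0 !ebump_le0 // mulr0 subrr.
  exact: is_derive_quadratic (ebump_quadratic m).
Unshelve. all: by end_near. Qed.

(** The linear span, since the derivative of one [ebump] is a combination of two others; this is the
    closed family to which [Ck_comp] applies. *)
Inductive ebump_span : (R -> R) -> Prop :=
| ebump_span1 m : ebump_span (ebump m)
| ebump_span_lin (c : R) f g : ebump_span f -> ebump_span g ->
    ebump_span (fun y => c * f y + g y).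

Lemma ebump_span_derive (g : R -> R) : ebump_span g ->
  exists2 g' : R -> R, ebump_span g' & forall y : R, setT y -> is_derive y 1 g (g' y).
Proof.
elim=> [m|c f {}g _ [f' sf df] _ [g' sg dg]].
  exists (fun y => (- m%:R) * ebump m.+1 y + ebump m.+2 y).
    by apply: ebump_span_lin; apply: ebump_span1.
  by move=> y _; rewrite mulNr addrC; exact: is_derive_ebump.
exists (fun y => c * f' y + g' y); first exact: ebump_span_lin.
move=> y _; have dfy := df y I; have dgy := dg y I.
exact: (@is_deriveD R R R (c *: f) g).
Qed.

Lemma Ck_ebump n m k (U : set 'rV[R]_n) f : open U -> Ck m U f ->
  Ck m U (fun x => ebump k (f x)).
Proof.
move=> oU; apply: (@Ck_comp _ _ setT ebump_span) => //; first exact: ebump_span_derive.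
exact: ebump_span1.
Qed.

Lemma ebump0_le (x y : R) : x <= y -> ebump 0 x <= ebump 0 y.
Proof.
move=> xy; have [x0|x0] := ltrP 0 x; last by rewrite ebump_le0 // ebump_ge0.
have y0 := lt_le_trans x0 xy.
by rewrite /ebump x0 y0 !expr0 !mul1r ler_expR lerN2 lef_pV2.
Qed.

(** The bump exp(-1/(1 - x^2)) supported in [-1, 1]. It decreases in |x|, hence [cutoff L] increases
    with [L]. *)
Definition eta (x : R) : R := ebump 0 (1 - x ^+ 2).
Definition eta' (x : R) : R := - (2 * x * ebump 2 (1 - x ^+ 2)).

Lemma is_derive_eta (x : R) : is_derive x 1 eta (eta' x).
Proof.
have dq : is_derive x 1 (fun z : R => 1 - z ^+ 2) (- (2 * x)).
  have h : is_derive x 1 (fun z : R => z ^+ 2) (2 * x).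
    have := is_deriveX 2 (is_derive_id x (1 : R)); rewrite exprfctE.
    by rewrite /GRing.scale /= expr1 mulr1.
  have := @is_deriveB R R R (cst 1) (fun z => z ^+ 2) x 1 0 (2 * x) (is_derive_cst _ _ _) h.
  by rewrite sub0r.
have := @is_derive1_comp R (ebump 0) _ x _ _ (is_derive_ebump 0 _) dq.
by congr (is_derive _ _ _ _); rewrite /eta' mul0r subr0; ring.
Qed.

Lemma continuous_ebump m : continuous (ebump m).
Proof.
move=> y; have [+ _] := is_derive_ebump m y.
by move/derivable1_diffP/differentiable_continuous.
Qed.

Lemma continuous_eta : continuous eta.
Proof.
move=> y; have [+ _] := is_derive_eta y.
by move/derivable1_diffP/differentiable_continuous.
Qed.

Lemma continuous_eta' : continuous eta'.
Proof.
move=> y; apply: cvgN; apply: cvgM; first by apply: cvgM; [exact: cvg_cst|exact: cvg_id].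
have c : {for y, continuous (fun x : R => 1 - x ^+ 2)}.
  by apply: cvgB; [exact: cvg_cst|exact: exprn_continuous].
exact: (@continuous_comp _ _ _ (fun x : R => 1 - x ^+ 2) (ebump 2) y c
  (@continuous_ebump 2 (1 - y ^+ 2))).
Qed.

Lemma eta_ge0 x : 0 <= eta x.
Proof. exact: ebump_ge0. Qed.

Lemma eta_gt0 x : `|x| < 1 -> 0 < eta x.
Proof.
by move=> x1; apply: ebump_gt0; rewrite subr_gt0 -[ltLHS]real_normK ?num_real // expr_lt1.
Qed.

Lemma eta_out x : 1 <= `|x| -> eta x = 0.
Proof.
move=> x1; apply: ebump_le0.
by rewrite subr_le0 -[leRHS]real_normK ?num_real // expr_ge1.
Qed.

Lemma eta'_out x : 1 <= `|x| -> eta' x = 0.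
Proof.
move=> x1; rewrite /eta' ebump_le0 ?mulr0 ?oppr0 //.
by rewrite subr_le0 -[leRHS]real_normK ?num_real // expr_ge1.
Qed.

Lemma eta_le x y : `|y| <= `|x| -> eta x <= eta y.
Proof.
move=> yx; apply: ebump0_le; rewrite lerD2l lerN2.
by rewrite -[leLHS]real_normK ?num_real // -[leRHS]real_normK ?num_real // lerXn2r ?nnegrE.
Qed.

Lemma Ck_eta n m (U : set 'rV[R]_n) f : open U -> Ck m U f -> Ck m U (fun x => eta (f x)).
Proof.
move=> oU cf; apply: Ck_ebump => //; apply: CkD => //; first exact: Ck_cst.
apply: (@eq_Ck _ _ _ _ (fun x => -1 * (f x * f x))) => //; first by move=> y _; ring.
by apply: CkM => //; [exact: Ck_cst|exact: CkM].
Qed.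

End Bump.

(** * One-dimensional integrals of the layers and choice of a single scale *)

Section Layers.
Context {R : realType}.
Local Notation I := (Rintegral (@lebesgue_measure R) setT).

Definition cutoff (L x : R) : R := eta (x / L) ^+ 2.
(** The square of the derivative of [eta (x / L)], times the 4 of the gradient bound
    [sigma_grad]. *)
Definition cutoff_slope (L x : R) : R := 4 * eta' (x / L) ^+ 2 / L ^+ 2.
(** The weight is s^(1 - 2c) on s > 0. For c = 1 it is ds/s, which is half of Lebesgue measure in
    the variable ln s^2. *)
Definition log_layer (c : R) (P : R -> R) (s : R) : R :=
  if 0 < s then expR ((2^-1 - c) * ln (s ^+ 2)) * P (ln (s ^+ 2)) else 0.
(** The weight (1 + s^2)^w with a profile in ln (1 + s^2), where s stands for x_{j+1} / |X_j|. *)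
Definition power_layer (w : R) (P : R -> R) (s : R) : R :=
  expR (w * ln (1 + s ^+ 2)) * P (ln (1 + s ^+ 2)).

Lemma add1_sqr_gt0 (s : R) : 0 < 1 + s ^+ 2.
Proof. by rewrite ltr_pwDl // sqr_ge0. Qed.

Lemma continuous_scaled (f : R -> R) (L : R) : continuous f -> continuous (fun x : R => f (x / L)).
Proof.
move=> cf x; have c1 : {for x, continuous (fun t : R => t / L)}.
  by apply: cvgM; [exact: cvg_id|exact: cvg_cst].
exact: (continuous_comp c1 (cf _)).
Qed.

Lemma compsupp_scale (M L : R) (f : R -> R) : 0 < L -> compsupp M f ->
  compsupp (M * L) (fun t => f (t / L) / L).
Proof.
move=> L0 [cf f0]; split=> [x|x Lx].
  apply: (@continuous_atM _ _ (fun t : R => f (t / L)) (fun=> L^-1)); last exact: cvg_cst.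
  exact: continuous_scaled.
by rewrite f0 ?mul0r // normrM normfV (gtr0_norm L0) ltr_pdivlMr.
Qed.

Lemma compsupp_cutoff (L : R) : 0 < L -> compsupp L (cutoff L).
Proof.
move=> L0; split=> x.
  by apply: cvgM; apply: continuous_scaled; exact: continuous_eta.
move=> Lx; rewrite /cutoff eta_out ?expr0n //.
by rewrite normrM normfV (gtr0_norm L0) ler_pdivlMr // mul1r ltW.
Qed.

Lemma compsupp_cutoff_slope (L : R) : 0 < L -> compsupp L (cutoff_slope L).
Proof.
move=> L0; split=> x.
  apply: cvgM; last exact: cvg_cst; apply: cvgM; first exact: cvg_cst.
  by apply: cvgM; apply: continuous_scaled; exact: continuous_eta'.
move=> Lx; rewrite /cutoff_slope eta'_out ?expr0n ?mulr0 ?mul0r //.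
by rewrite normrM normfV (gtr0_norm L0) ler_pdivlMr // mul1r ltW.
Qed.

Lemma cutoff_ge0 L x : 0 <= cutoff L x.
Proof. exact: sqr_ge0. Qed.

Lemma cutoff_slope_ge0 L x : 0 <= cutoff_slope L x.
Proof. by rewrite divr_ge0 ?sqr_ge0 // mulr_ge0 ?sqr_ge0 //. Qed.

Lemma cutoff0_gt0 L : 0 < cutoff L 0.
Proof. by rewrite exprn_gt0 // eta_gt0 // mul0r normr0. Qed.

Lemma compsupp_log_layer (L c : R) P : 0 <= L -> compsupp L P ->
  compsupp (expR L) (log_layer c P).
Proof.
move=> L0 [cP P0]; split; last first.
  move=> s; rewrite /log_layer; case: ifP => // s0; rewrite (gtr0_norm s0) => Ls.
  rewrite P0 ?mulr0 // lnXn // mulr2n.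
  have H : L < ln s by rewrite -ltr_expR lnK.
  by rewrite ger0_norm; lra.
move=> s; have [s0|s0] := ltrP 0 s; last first.
  (* Below exp(-L - 1) the argument ln z^2 is less than -L, where [P] vanishes; the layer is
     therefore 0 in a neighbourhood of every s <= 0. *)
  have e0 : 0 < expR (- L - 1) by exact: expR_gt0.
  apply: (near_eq_continuous_at (f := fun=> 0)); last exact: cvg_cst.
  near=> z; rewrite /log_layer; case: ifP => // z0.
  rewrite P0 ?mulr0 // lnXn // mulr2n.
  have H : ln z < - L - 1.
    by rewrite -ltr_expR lnK //; near: z; apply: lt_nbhsl; exact: le_lt_trans e0.
  by rewrite ltr0_norm; lra.
apply: (near_eq_continuous_at
  (f := fun z : R => expR ((2^-1 - c) * ln (z ^+ 2)) * P (ln (z ^+ 2)))).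
  by near=> z; rewrite /log_layer ifT //; near: z; exact: lt_nbhsr.
have cl : {for s, continuous (fun z : R => ln (z ^+ 2))}.
  apply: (@continuous_comp _ _ _ (fun z : R => z ^+ 2) (@ln R)).
    exact: exprn_continuous.
  by apply: continuous_ln; rewrite exprn_gt0.
apply: continuous_atM; last first.
  exact: (@continuous_comp _ _ _ (fun z : R => ln (z ^+ 2)) P s cl (cP _)).
apply: (@continuous_comp _ _ _ (fun z : R => (2^-1 - c) * ln (z ^+ 2)) expR s).
  by apply: continuous_atM => //; exact: cvg_cst.
exact: continuous_expR.
Unshelve. all: by end_near. Qed.

Lemma compsupp_power_layer (L w : R) P : compsupp L P -> compsupp (expR L) (power_layer w P).
Proof.
move=> [cP P0]; split; last first.
  move=> s Ls; rewrite /power_layer P0 ?mulr0 //; apply: lt_le_trans (ler_norm _).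
  rewrite -ltr_expR lnK ?posrE ?add1_sqr_gt0 //; apply: lt_le_trans Ls _.
  (* From (|s| - 1)^2 >= 0 one gets 1 + s^2 >= 2|s| >= |s|. *)
  have := sqr_ge0 (`|s| - 1); rewrite -[s ^+ 2]real_normK ?num_real //.
  have := normr_ge0 s; move: `|s| => r; nra.
move=> s; have cl : {for s, continuous (fun z : R => ln (1 + z ^+ 2))}.
  apply: (@continuous_comp _ _ _ (fun z : R => 1 + z ^+ 2) (@ln R)).
    by apply: continuous_atD; [exact: cvg_cst|exact: exprn_continuous].
  by apply: continuous_ln; exact: add1_sqr_gt0.
apply: (@continuous_atM _ _ (fun z : R => expR (w * ln (1 + z ^+ 2)))
    (fun z : R => P (ln (1 + z ^+ 2)))); last first.
  exact: (@continuous_comp _ _ _ (fun z : R => ln (1 + z ^+ 2)) P s cl (cP _)).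
apply: (@continuous_comp _ _ _ (fun z : R => w * ln (1 + z ^+ 2)) expR s).
  by apply: continuous_atM => //; exact: cvg_cst.
exact: continuous_expR.
Qed.

Lemma log_layer_gt0 (L c : R) : 0 < L -> 0 < I (log_layer c (cutoff L)).
Proof.
move=> L0; apply: (Rintegral_gt0 (x0 := 1)
  (compsupp_log_layer c (ltW L0) (compsupp_cutoff L0))).
  move=> s; rewrite /log_layer; case: ifP => // _.
  by rewrite mulr_ge0 ?expR_ge0 ?cutoff_ge0.
by rewrite /log_layer ltr01 expr1n ln1 mulr_gt0 ?expR_gt0 ?cutoff0_gt0.
Qed.

Lemma power_layer_gt0 (L w : R) : 0 < L -> 0 < I (power_layer w (cutoff L)).
Proof.
move=> L0; apply: (Rintegral_gt0 (x0 := 0)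
  (compsupp_power_layer w (compsupp_cutoff L0))).
  by move=> s; rewrite mulr_ge0 ?expR_ge0 ?cutoff_ge0.
by rewrite /power_layer expr0n addr0 ln1 mulr_gt0 ?expR_gt0 ?cutoff0_gt0.
Qed.

Lemma cutoff_gt0 (L : R) : 0 < L -> 0 < I (cutoff L).
Proof.
move=> L0; apply: (Rintegral_gt0 (x0 := 0) (compsupp_cutoff L0)).
  exact: cutoff_ge0.
exact: cutoff0_gt0.
Qed.

Lemma Rintegral_log_layer1 (L : R) P : 0 < L -> compsupp L P -> I (log_layer 1 P) = 2^-1 * I P.
Proof.
move=> L0 cP; have [K K0 HK] := compsupp_ex cP.
pose N := Num.max K (2 * L).
have [G [dG ->]] := HK N ltac:(by rewrite le_max lexx).
have N0 : 0 < N by rewrite lt_max K0.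
have LN : 2 * L <= N by rewrite le_max lexx orbT.
apply: etrans; first apply: (@Rintegral_FTC _ _ (fun s => 2^-1 * G (ln s *+ 2))
  (expR (- N / 2)) (expR (N / 2))).
- by rewrite ltr_expR; lra.
- exact: (compsupp_log_layer 1 (ltW L0) cP).1.
- move=> s; rewrite /log_layer; case: ifP => // s0 sN; rewrite cP.2 ?mulr0 //.
  rewrite lnXn // ltNge; apply: contra sN; rewrite ler_norml mulr2n => /andP[h1 h2].
  by rewrite -[s]lnK // !ler_expR; apply/andP; split; lra.
- move=> s /andP[s1 s2]; have s0 : 0 < s by apply: lt_le_trans s1; exact: expR_gt0.
  rewrite -[s]lnK // !ler_expR in s1 s2.
  have sN : - N <= ln s *+ 2 <= N by rewrite mulr2n; lra.
  have dl : is_derive s 1 (fun t : R => ln t *+ 2) (s^-1 *+ 2).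
    have := is_deriveD (is_derive1_ln s0) (is_derive1_ln s0).
    by congr (is_derive _ _ _ _); rewrite ?mulr2n.
  have := @is_deriveZ R R R _ 2^-1 s 1 _ (@is_derive1_comp R G _ s _ _ (dG _ sN) dl).
  congr (is_derive _ _ _ _).
  rewrite /GRing.scale /= /log_layer s0 lnXn // mulr2n.
  have -> : (2^-1 - 1 : R) * (ln s + ln s) = - ln s by field.
  by rewrite expRN lnK //; field; rewrite gt_eqF.
rewrite /= !expRK.
have -> : N / 2 *+ 2 = N by rewrite mulr2n; lra.
have -> : - N / 2 *+ 2 = - N by rewrite mulr2n; lra.
by rewrite mulrBr.
Qed.

Lemma Rintegral_cutoff (L : R) : 0 < L -> I (cutoff L) = L * I (fun x => eta x ^+ 2).
Proof.
move=> L0; have c1 : compsupp 1 (cutoff (1 : R)) by exact: compsupp_cutoff.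
have E : (fun x => eta x ^+ 2) = cutoff (1 : R).
  by apply/funext => x; rewrite /cutoff divr1.
rewrite E -(Rintegral_scale L0 c1).
have cL : compsupp L (fun t => cutoff 1 (t / L) / L).
  by rewrite -[X in compsupp X]mul1r; exact: compsupp_scale.
rewrite -(RintegralZ _ cL); congr (Rintegral _ _ _); apply/funext => x.
by rewrite /cutoff divr1; field; rewrite gt_eqF.
Qed.

Lemma Rintegral_cutoff_slope (L : R) : 0 < L ->
  I (cutoff_slope L) = L^-1 * I (cutoff_slope 1).
Proof.
move=> L0; have c1 : compsupp 1 (cutoff_slope (1 : R)) by exact: compsupp_cutoff_slope.
rewrite -(Rintegral_scale L0 c1).
have cL : compsupp L (fun t => cutoff_slope 1 (t / L) / L).
  by rewrite -[X in compsupp X]mul1r; exact: compsupp_scale.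
rewrite -(RintegralZ _ cL); congr (Rintegral _ _ _); apply/funext => x.
by rewrite /cutoff_slope !divr1; field; rewrite gt_eqF.
Qed.

Lemma ex_cutoff (e : R) : 0 < e ->
  exists2 L, 1 <= L & I (cutoff_slope L) <= e * I (cutoff L).
Proof.
move=> e0; pose D := I (fun x : R => eta x ^+ 2); pose E := I (cutoff_slope 1).
have D0 : 0 < D by have := cutoff_gt0 (@ltr01 R); rewrite Rintegral_cutoff // mul1r.
have E0 : 0 <= E by apply: Rintegral_ge0 => x _; exact: cutoff_slope_ge0.
(* By scaling the integrals are E / L and L D. As L >= 1, the claim E / L <= e L D follows from E <=
   e D L = e D + E. *)
pose L := 1 + E / (e * D).
have L1 : 1 <= L by rewrite lerDl divr_ge0 // ltW // mulr_gt0.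
have L0 : 0 < L by lra.
exists L; first exact: L1.
rewrite Rintegral_cutoff // Rintegral_cutoff_slope // -/D -/E.
rewrite mulrC ler_pdivrMr //; apply: (@le_trans _ _ (e * D * L)); last first.
  have -> : e * (L * D) * L = L * (e * D * L) by ring.
  by rewrite ler_peMl // !mulr_ge0 // ltW.
have eD : 0 < e * D by rewrite mulr_gt0.
by rewrite /L mulrDr mulr1 mulrCA mulfV ?gt_eqF // mulr1 lerDr ltW.
Qed.

Lemma ex_log_layer (e : R) : 0 < e -> exists2 L, 1 <= L &
  I (log_layer 1 (cutoff_slope L)) <= e * I (log_layer 1 (cutoff L)).
Proof.
move=> e0; have [L L1 H] := ex_cutoff e0; exists L; first exact: L1.
have L0 : 0 < L by lra.
rewrite (Rintegral_log_layer1 L0 (compsupp_cutoff_slope L0)).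
by rewrite (Rintegral_log_layer1 L0 (compsupp_cutoff L0)) mulrCA ler_pM2l.
Qed.

(** The function is asinh, a primitive of the borderline weight (1 + s^2)^(-1/2); it grows only like
    ln |s|. *)
Lemma is_derive_asinh (s : R) :
  is_derive s 1 (fun t : R => ln (t + Num.sqrt (1 + t ^+ 2))) (expR (- 2^-1 * ln (1 + s ^+ 2))).
Proof.
have q0 := add1_sqr_gt0 s.
pose r := Num.sqrt (1 + s ^+ 2).
have r0 : 0 < r by rewrite sqrtr_gt0.
have r2 : r ^+ 2 = 1 + s ^+ 2 by rewrite sqr_sqrtr // ltW.
have p0 : 0 < s + r.
  rewrite -ltrBlDl sub0r; apply: le_lt_trans (ler_norm _) _.
  by rewrite normrN -sqrtr_sqr ltr_sqrt // ltrDr.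
have dq : is_derive s 1 (fun z : R => 1 + z ^+ 2) (2 * s).
  have h : is_derive s 1 (fun z : R => z ^+ 2) (2 * s).
    have := is_deriveX 2 (is_derive_id s (1 : R)); rewrite exprfctE.
    by rewrite /GRing.scale /= expr1 mulr1.
  have := @is_deriveD R R R (cst 1) (fun z => z ^+ 2) s 1 0 (2 * s) (is_derive_cst _ _ _) h.
  by rewrite add0r.
have ds := @is_derive1_comp R Num.sqrt (fun z : R => 1 + z ^+ 2) s _ _ (is_derive1_sqrt q0) dq.
have d1 := @is_deriveD R R R id (fun z : R => Num.sqrt (1 + z ^+ 2)) s 1 _ _
  (is_derive_id s (1 : R)) ds.
have := @is_derive1_comp R (@ln R) (fun z : R => z + Num.sqrt (1 + z ^+ 2)) s _ _
  (is_derive1_ln p0) d1.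
congr (is_derive _ _ _ _).
have -> : expR (- 2^-1 * ln (1 + s ^+ 2)) = r^-1.
  rewrite mulNr expRN; congr (_^-1); rewrite -r2 lnXn // mulr2n.
  have -> : 2^-1 * (ln r + ln r) = ln r by field.
  by rewrite lnK.
by rewrite -/r; field; rewrite !gt_eqF.
Qed.

(** 48 = 2 * 4!, with |x| < 1 and the bound 4! for [ebump 2] on [0, 1] coming from
    [ebump_quadratic]. *)
Lemma normr_eta'_le (x : R) : `|eta' x| <= 48.
Proof.
have [x1|x1] := lerP 1 `|x|; first by rewrite eta'_out // normr0.
have := ebump_quadratic 2 (1 - x ^+ 2); set b := ebump _ _ => H.
have x2 : x ^+ 2 <= 1 by rewrite -[leLHS]real_normK ?num_real // exprn_ile1 // ltW.
have f4 : 4`!%:R = 24 :> R by [].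
have b24 : `|b| <= 24.
  apply: le_trans H _; rewrite f4 ler_piMr // exprn_ile1 //; first by lra.
  by have := sqr_ge0 x; lra.
rewrite /eta' -/b normrN !normrM (ger0_norm (ler0n _ 2)).
have := normr_ge0 x; have := normr_ge0 b; move: `|x| `|b| x1 b24 => u v; nra.
Qed.

Lemma ex_eta'_bound : exists2 C : R, 0 < C & forall x : R, 4 * eta' x ^+ 2 <= C.
Proof.
exists (4 * 48 ^+ 2) => [|x]; first by rewrite mulr_gt0 ?exprn_gt0 ?ltr0n.
apply: ler_wpM2l; first by rewrite ler0n.
rewrite -[leLHS]real_normK ?num_real // lerXn2r ?nnegrE ?ler0n //.
exact: normr_eta'_le.
Qed.

Lemma cutoff_le (L x : R) : 1 <= L -> cutoff 1 x <= cutoff L x.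
Proof.
move=> L1; rewrite /cutoff lerXn2r ?nnegrE ?eta_ge0 // eta_le // divr1 normrM.
by rewrite ler_piMr // normfV ger0_norm ?invf_le1; lra.
Qed.

(** The left integrand is at most (C / L^2) (1 + s^2)^(-1/2) and lives on |s| <= exp L, where this
    weight has integral at most 6 L; the total 6 C / L tends to 0. The right integral stays above
    its value at L = 1 because cutoffs increase with L. *)
Lemma ex_power_layer (w e : R) : w <= - 2^-1 -> 0 < e -> exists2 L, 1 <= L &
  I (power_layer w (cutoff_slope L)) <= e * I (power_layer (w - 1) (cutoff L)).
Proof.
move=> w2 e0.
have [D D0 DL] : exists2 D : R, 0 < D &
    forall L, 1 <= L -> D <= I (power_layer (w - 1) (cutoff L)).
  exists (I (power_layer (w - 1) (cutoff 1))); first exact: power_layer_gt0.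
  move=> L L1; have L0 : 0 < L by lra.
  apply: (Rintegral_le (compsupp_power_layer _ (compsupp_cutoff ltr01))
    (compsupp_power_layer _ (compsupp_cutoff L0))) => s.
  by apply: ler_wpM2l; [exact: expR_ge0|exact: cutoff_le].
have [C C0 etaC] := ex_eta'_bound.
pose L := 1 + 6 * C / (e * D).
have eD : 0 < e * D by rewrite mulr_gt0.
have L1 : 1 <= L by rewrite lerDl divr_ge0 // ltW // mulr_gt0.
have L0 : 0 < L by lra.
exists L; first exact: L1.
apply: (@le_trans _ _ (e * D)); last by apply: ler_wpM2l; [exact: ltW|exact: DL].
apply: (@le_trans _ _ (C / L ^+ 2 * (6 * L))); last first.
  have -> : C / L ^+ 2 * (6 * L) = 6 * C / L by field; rewrite gt_eqF.
  rewrite (ler_pdivrMr _ _ L0).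
  have -> : e * D * L = e * D + 6 * C by rewrite /L; field; rewrite !gt_eqF.
  by rewrite lerDr; exact: ltW.
have cB := compsupp_power_layer w (compsupp_cutoff_slope L0).
have [G dG] := ex_antiderivative (- expR L) (expR L) cB.1.
have N0 : 0 < expR L by exact: expR_gt0.
rewrite (Rintegral_FTC (a := - expR L) (b := expR L) _ cB.1 _ dG); first last.
- by move=> x; rewrite -ler_norml -ltNge => /cB.2.
- by lra.
pose H (t : R) := ln (t + Num.sqrt (1 + t ^+ 2)).
(* The comparison weight is not compactly supported, so the integrals are compared through the
   increment of a difference of primitives, given by the mean value theorem. *)
have [] := @mvt_closed R (fun t => C / L ^+ 2 * H t - G t)
  (fun t => C / L ^+ 2 * expR (- 2^-1 * ln (1 + t ^+ 2)) - power_layer w (cutoff_slope L) t)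
  (- expR L) (expR L).
- by lra.
- move=> x xL; have h1 := is_derive_asinh x; have h2 := dG x xL.
  exact: (@is_deriveB R R R (C / L ^+ 2 *: H) G).
move=> s _ E.
have : 0 <= C / L ^+ 2 * expR (- 2^-1 * ln (1 + s ^+ 2)) -
    power_layer w (cutoff_slope L) s.
  rewrite subr_ge0 /power_layer mulrC; apply: ler_pM.
  - exact: cutoff_slope_ge0.
  - exact: expR_ge0.
  - by rewrite /cutoff_slope ler_wpM2r ?invr_ge0 ?sqr_ge0.
  - by rewrite ler_expR ler_wpM2r // ln_ge0 // lerDl sqr_ge0.
move=> p; have {E p} : 0 <= C / L ^+ 2 * H (expR L) - G (expR L) -
    (C / L ^+ 2 * H (- expR L) - G (- expR L)).
  by rewrite E mulr_ge0 //; lra.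
suff : H (expR L) - H (- expR L) <= 6 * L.
  by rewrite -(ler_pM2l (_ : 0 < C / L ^+ 2)) ?divr_gt0 ?exprn_gt0 // mulrBr; lra.
rewrite /H sqrrN; set r := Num.sqrt _.
have q0 : 0 <= 1 + expR L ^+ 2 by exact/ltW/add1_sqr_gt0.
have r2 : r ^+ 2 = 1 + expR L ^+ 2 by rewrite sqr_sqrtr.
have r0 : 0 <= r by exact: sqrtr_ge0.
have eL : 2 <= expR L by have := expR_ge1Dx L; lra.
have rL : expR L < r by move: r2 r0 N0; move: (expR L) => a; nra.
(* Oddness of asinh, from r^2 - exp(L)^2 = 1. *)
have -> : - expR L + r = (expR L + r)^-1.
  apply: (mulIf (lt0r_neq0 (_ : 0 < expR L + r))); first by lra.
  by rewrite mulVf; [have -> : (- expR L + r) * (expR L + r) = r ^+ 2 - expR L ^+ 2 by ring|]; lra.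
have p0 : 0 < expR L + r by lra.
rewrite lnV ?posrE // opprK.
suff : ln (expR L + r) <= 3 * L by lra.
rewrite -ler_expR lnK ?posrE //.
(* With a = exp L >= 2 and r <= a + 1, the bound reads a + r <= 4 a <= a^3. *)
have -> : 3 * L = L + L + L by ring.
rewrite (expRD (L + L) L) (expRD L L); move: r2 r0 rL eL; move: (expR L) => a r2 r0 rL a2.
have ra : r <= a + 1 by nra.
have aa : 4 <= a * a by nra.
by apply: (@le_trans _ _ (4 * a)); [lra|apply: ler_wpM2r; lra].
Qed.

End Layers.

(** * The logarithmic gradient of the ground state and its Riccati equation *)

Section GroundState.
Context {R : realType} {n : nat}.
Local Notation rV := 'rV[R]_n.+1.
Local Notation U := (@halfspace R n.+1).
Implicit Types (u : rV -> R) (x : rV) (i j : 'I_n.+1) (a : nat -> R) (K : set rV).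

Lemma halfspaceE x : U x <-> 0 < x 0 ord0.
Proof.
split=> [H|H j j0]; first exact: H.
by have -> : j = ord0 by apply/val_inj.
Qed.

Lemma open_halfspace : open U.
Proof.
have -> : U = (fun x : rV => x 0 ord0) @^-1` [set t | 0 < t].
  by apply/seteqP; split=> x /halfspaceE.
apply: open_comp; [by move=> x _; exact: coord_continuous|exact: open_gt].
Qed.

Lemma rsq_ge0 m x : 0 <= rsq m x.
Proof. by apply: sumr_ge0 => j _; exact: sqr_ge0. Qed.

Lemma rsq_gt0 m x : U x -> (0 < m)%N -> 0 < rsq m x.
Proof.
move=> /halfspaceE x0 m0; rewrite /rsq (bigD1 ord0) //=.
by rewrite ltr_pwDl ?exprn_gt0 // sumr_ge0 // => j _; exact: sqr_ge0.
Qed.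

Lemma Ck_rsq k m (V : set rV) : open V -> Ck k V (rsq m).
Proof.
move=> oV; apply: Ck_sum => // j _; apply: (@eq_Ck _ _ _ _ (fun x => x 0 j * x 0 j)) => //.
by apply: CkM => //; exact: Ck_coord.
Qed.

Lemma is_derive_bigsum (T : Type) (r : seq T) (P : pred T) (f : T -> rV -> R) (x v : rV)
    (d : T -> R) : (forall t, P t -> is_derive x v (f t) (d t)) ->
  is_derive x v (fun y => \sum_(t <- r | P t) f t y) (\sum_(t <- r | P t) d t).
Proof.
move=> df; elim: r => [|t r IH].
  by rewrite big_nil; under eq_fun do rewrite big_nil; exact: is_derive_cst.
rewrite big_cons; have [Pt|/negbTE Pt] := boolP (P t);
  under eq_fun do rewrite big_cons Pt; last exact: IH.
by have h := df t Pt; exact: is_deriveD.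
Qed.

Lemma is_derive_rsq m i x : is_derive x (delta_mx 0 i) (rsq m) ((i < m)%:R * (2 * x 0 i)).
Proof.
have -> : (i < m)%:R * (2 * x 0 i) =
    \sum_(j < n.+1 | (j < m)%N) (x 0 j * (j == i)%:R + x 0 j * (j == i)%:R).
  rewrite big_mkcond (bigD1 i) //= big1 ?addr0 => [|j /negbTE ->].
    by rewrite eqxx; case: (i < m)%N; rewrite ?mul0r //= mul1r; ring.
  by rewrite !mulr0 addr0; case: ifP.
apply: is_derive_bigsum => j _.
have h := is_derive_coord j i x.
by have := is_deriveM h h.
Qed.

(** The i-th component of X_m / |X_m|^2, the gradient of ln |X_m|; [radial'] is its derivative in
    the same coordinate, a summand of the divergence. *)
Definition radial m i x : R := (i < m)%:R * x 0 i / rsq m x.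
Definition radial' m i x : R :=
  (i < m)%:R * ((rsq m x)^-1 - 2 * x 0 i ^+ 2 / rsq m x ^+ 2).

Lemma is_derive_radial m i x : U x -> (0 < m)%N ->
  is_derive x (delta_mx 0 i) (radial m i) (radial' m i x).
Proof.
move=> Ux m0; have q0 := rsq_gt0 Ux m0.
have h1 := is_derive_coord i i x; rewrite eqxx in h1.
have h2 := is_derive_comp_dir (is_derive_inv (lt0r_neq0 q0)) (is_derive_rsq m i x).
have := @is_deriveZ R _ _ _ (i < m)%:R x (delta_mx 0 i) _ (is_deriveM h1 h2).
congr (is_derive _ _ _ _).
  by apply/funext => y; rewrite /radial -mulrA.
rewrite /radial' /GRing.scale /=; case: (i < m)%N; last by rewrite !mul0r.
have -> : true%:R = 1 :> R by [].
by field; rewrite gt_eqF.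
Qed.

Lemma Ck_radial k m i : (0 < m)%N -> Ck k U (radial m i).
Proof.
move=> m0; have oU := open_halfspace; apply: CkM => //; last first.
  by apply: Ck_inv => // [y Uy|]; [exact: rsq_gt0|exact: Ck_rsq].
by apply: CkM => //; [exact: Ck_cst|exact: Ck_coord].
Qed.

(** For m <= l the inner product of X_m and X_l is |X_m|^2, which cancels one denominator. *)
Lemma sum_radialM m l x : U x -> (0 < m)%N -> (m <= l)%N ->
  \sum_i radial m i x * radial l i x = (rsq l x)^-1.
Proof.
move=> Ux m0 ml; have q0 := rsq_gt0 Ux m0; have ql := rsq_gt0 Ux (leq_trans m0 ml).
transitivity (\sum_(i < n.+1 | (i < m)%N) x 0 i ^+ 2 / (rsq m x * rsq l x)).
  rewrite [RHS]big_mkcond; apply: eq_bigr => i _; rewrite /radial.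
  case: ifP => im; last by rewrite !mul0r.
  by rewrite (leq_trans im ml) !mul1r; field; rewrite !gt_eqF.
by rewrite -mulr_suml -/(rsq m x); field; rewrite !gt_eqF.
Qed.

(** The divergence of X / |X|^2 in dimension m. *)
Lemma sum_radial' m x : U x -> (0 < m)%N -> (m <= n.+1)%N ->
  \sum_i radial' m i x = (m%:R - 2) / rsq m x.
Proof.
move=> Ux m0 mn; have q0 := rsq_gt0 Ux m0.
transitivity (\sum_(i < n.+1 | (i < m)%N) ((rsq m x)^-1 - 2 * x 0 i ^+ 2 / rsq m x ^+ 2)).
  rewrite [RHS]big_mkcond; apply: eq_bigr => i _; rewrite /radial'.
  by case: ifP; rewrite ?mul1r ?mul0r.
rewrite sumrB -mulr_suml -mulr_sumr -/(rsq m x).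
have -> : \sum_(i < n.+1 | (i < m)%N) (rsq m x)^-1 = m%:R / rsq m x.
  rewrite -(big_ord_widen_cond n.+1 predT (fun=> (rsq m x)^-1)) //.
  by rewrite sumr_const card_ord mulr_natl.
by field; rewrite gt_eqF.
Qed.

(* The exponents of the ground state [\prod_m |X_m| ^ g_m], where [|X_m|^2 = rsq m]. *)
Definition gexp a (m : nat) : R :=
  if m == 1%N then 2^-1 - a 1%N else a m.-1 - a m - 2^-1.

Lemma sum_gexp a m : \sum_(1 <= l < m.+2) gexp a l = 2^-1 - a m.+1 - m%:R / 2.
Proof.
elim: m => [|m IH]; first by rewrite big_nat1 /gexp eqxx mul0r subr0.
rewrite big_nat_recr //= IH /gexp /= -[m.+1%:R]natr1; lra.
Qed.

(** The i-th component of grad phi / phi for the product of the first [M] powers; [dfield_i] is its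
    derivative in coordinate i. *)
Definition field_i a M i x : R := \sum_(1 <= m < M.+1) gexp a m * radial m i x.
Definition dfield_i a M i x : R := \sum_(1 <= m < M.+1) gexp a m * radial' m i x.

(** The left side is Delta phi / phi. A new radius adds only a multiple of 1 / |X_{M+1}|^2, since by
    [sum_radialM] its inner products with the earlier radial fields all equal that function. With g
    = g_{M+1} and G the sum of the earlier exponents, the coefficient g (M - 1) + 2 g G + g^2 is
    -beta_{M+1}. *)
Lemma riccati a M x : U x -> (M <= n.+1)%N ->
  \sum_i (dfield_i a M i x + field_i a M i x ^+ 2) =
  - \sum_(1 <= m < M.+1) hbeta a m / rsq m x.
Proof.
move=> Ux; elim: M => [|M IH] Mn.
  by rewrite big_nil oppr0 big1 // => i _; rewrite /dfield_i /field_i !big_nil expr0n addr0.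
have q0 := @rsq_gt0 M.+1 x Ux isT.
rewrite big_nat_recr //= opprD -IH ?(ltnW Mn) //.
have -> : \sum_i (dfield_i a M.+1 i x + field_i a M.+1 i x ^+ 2) =
    \sum_i (dfield_i a M i x + field_i a M i x ^+ 2) +
    (gexp a M.+1 * \sum_i radial' M.+1 i x +
     2 * gexp a M.+1 * \sum_i field_i a M i x * radial M.+1 i x +
     gexp a M.+1 ^+ 2 * \sum_i radial M.+1 i x * radial M.+1 i x).
  rewrite !mulr_sumr -!big_split; apply: eq_bigr => i _ /=.
  by rewrite /dfield_i /field_i ![\sum_(1 <= m < M.+2) _]big_nat_recr //=; ring.
congr (_ + _); rewrite sum_radialM // sum_radial' //.
have -> : \sum_i field_i a M i x * radial M.+1 i x =
    (\sum_(1 <= m < M.+1) gexp a m) / rsq M.+1 x.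
  under eq_bigr do rewrite mulr_suml.
  rewrite exchange_big /= mulr_suml !big_nat; apply: eq_bigr => m /andP[m1 mM].
  rewrite -(sum_radialM Ux m1 (leqW (ltnSE mM))) mulr_sumr.
  by apply: eq_bigr => i _; rewrite mulrA.
case: M {IH Mn} q0 => [|M] q0.
  by rewrite big_nil /gexp /hbeta !eqxx; field; rewrite gt_eqF.
by rewrite sum_gexp /gexp /hbeta /= -[M.+2%:R]natr1 -[M.+1%:R]natr1; field; rewrite gt_eqF.
Qed.

End GroundState.

(** * The Hardy identity with remainder *)

Section HardyIdentity.
Context {R : realType} {n : nat}.
Local Notation rV := 'rV[R]_n.+1.
Local Notation U := (@halfspace R n.+1).
Implicit Types (u f : rV -> R) (x : rV) (i j : 'I_n.+1) (a : nat -> R) (K : set rV).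

Lemma compact_coord_bound K : compact K ->
  exists2 M : R, 0 <= M & forall x j, K x -> `|x 0 j| <= M.
Proof.
move=> cK; have [M [Mr HM]] := compact_bounded cK.
exists (`|M| + 1) => [|x j Kx]; first by rewrite addr_ge0.
have := HM (`|M| + 1) ltac:(by rewrite (le_lt_trans (ler_norm M)) // ltrDl) x Kx.
apply: le_trans.
rewrite [leRHS]/Num.Def.normr /= mx_normrE; apply/bigmax_geP; right => /=.
by exists (0, j).
Qed.

Lemma compact_rV_closed K : compact K -> closed K.
Proof. by apply: compact_closed; exact: norm_hausdorff. Qed.

(** The potentials blow up on the boundary of the half-space; a support compact inside it allows
    extension by zero. *)
Lemma unifcompsupp_halfspace K (M : R) f : compact K -> K `<=` U ->
  (forall x j, K x -> `|x 0 j| <= M) -> (forall x, ~ K x -> f x = 0) ->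
  Ck 0 U f -> unifcompsupp M f.
Proof.
move=> cK KU KM f0 cf; apply: continuous_unifcompsupp.
  have := Ck_extend (@open_halfspace R n) (compact_rV_closed cK) KU f0 cf.
  by move=> H x; apply: H.
move=> x j; have [Kx|/f0 //] := pselect (K x).
by rewrite ltNge KM.
Qed.

Lemma partial_out K u i x : closed K -> (forall x, ~ K x -> u x = 0) -> ~ K x ->
  partial i u x = 0.
Proof.
move=> cK u0 Kx; rewrite (eq_partial (g := fun=> 0) i (closed_openC cK)) //.
exact: derive_cst.
Qed.

Lemma smooth_Ck1 u (V : set rV) : smooth u -> Ck 2 V u.
Proof.
move=> su; have [c0 d0] := su [::]; split=> [x _|i]; first exact: c0.
have [c1 d1] := su [:: i]; split=> [x _|]; first exact: d0.
split=> [x _|j]; first exact: c1.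
have [c2 d2] := su [:: j; i]; split=> [x _|x _]; first exact: d1.
exact: c2.
Qed.

Lemma Ck_field_i k a M i : Ck k U (field_i a M i).
Proof.
have oU := @open_halfspace R n.
rewrite /field_i; under eq_fun do rewrite big_nat.
apply: Ck_sum => // m /andP[m1 _]; apply: CkM => //; first exact: Ck_cst.
exact: Ck_radial.
Qed.

Lemma is_derive_field_i a M i x : U x ->
  is_derive x (delta_mx 0 i) (field_i a M i) (dfield_i a M i x).
Proof.
move=> Ux; rewrite /field_i /dfield_i big_nat; under eq_fun do rewrite big_nat.
apply: is_derive_bigsum => m /andP[m1 _].
have h := is_derive_radial i Ux m1.
exact: (@is_deriveZ R _ _ _ (gexp a m) x).
Qed.

Definition excess a M u x : R := \sum_i (partial i u x - u x * field_i a M i x) ^+ 2.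

(** Completing the square with F = grad phi / phi leaves 2 u grad u . F - u^2 |F|^2, that is div
    (u^2 F) - u^2 (div F + |F|^2), and [riccati] evaluates the bracket. *)
Lemma gradsq_expand a M u x : U x -> (M <= n.+1)%N -> Ck 1 U u ->
  gradsq u x = \sum_(1 <= m < M.+1) hbeta a m * (u x ^+ 2 / rsq m x) + excess a M u x +
    \sum_i partial i (fun y => u y ^+ 2 * field_i a M i y) x.
Proof.
move=> Ux Mn cu.
have E i : partial i (fun y => u y ^+ 2 * field_i a M i y) x =
    u x ^+ 2 * dfield_i a M i x + field_i a M i x * (2 * u x * partial i u x).
  have h1 := is_derive_field_i a M i Ux.
  have h2 := Ck_is_derive i cu Ux.
  have h3 : is_derive x (delta_mx 0 i) (fun y => u y ^+ 2) (2 * u x * partial i u x).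
    by have := is_deriveX 2 h2; rewrite exprfctE /GRing.scale /= expr1.
  by have [_ e] := is_deriveM h3 h1; exact: e.
have -> : \sum_(1 <= m < M.+1) hbeta a m * (u x ^+ 2 / rsq m x) =
    - \sum_i u x ^+ 2 * (dfield_i a M i x + field_i a M i x ^+ 2).
  rewrite -mulr_sumr riccati // mulrN opprK mulr_sumr.
  by apply: eq_bigr => m _; ring.
rewrite /gradsq /excess -sumrN -!big_split; apply: eq_bigr => i _ /=.
by rewrite E; ring.
Qed.

Lemma unifcompsupp_quot K (B : R) u m : compact K -> K `<=` U ->
  (forall x j, K x -> `|x 0 j| <= B) -> (forall x, ~ K x -> u x = 0) -> smooth u ->
  (0 < m)%N -> unifcompsupp B (fun x => u x ^+ 2 / rsq m x).
Proof.
move=> cK KU KB u0 su m0; have oU := @open_halfspace R n.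
apply: (unifcompsupp_halfspace cK KU KB) => [x /u0 ->|]; first by rewrite expr0n mul0r.
apply: CkM => //; last by apply: Ck_inv => // [x Ux|]; [exact: rsq_gt0|exact: Ck_rsq].
have cu : Ck 0 U u by have := smooth_Ck1 U su => /CkS/CkS.
by apply: (@eq_Ck _ _ _ _ (fun x => u x * u x)) => //; exact: CkM.
Qed.

Lemma unifcompsupp_excess K (B : R) a M u : compact K -> K `<=` U ->
  (forall x j, K x -> `|x 0 j| <= B) -> (forall x, ~ K x -> u x = 0) -> smooth u ->
  unifcompsupp B (excess a M u).
Proof.
move=> cK KU KB u0 su; have oU := @open_halfspace R n.
have cu1 := CkS (smooth_Ck1 U su).
apply: unifcompsupp_sum => i _.
apply: (unifcompsupp_halfspace cK KU KB) => [x Kx|].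
  by rewrite (partial_out i (compact_rV_closed cK) u0 Kx) u0 // mul0r subr0 expr0n.
pose w x := partial i u x + -1 * (u x * field_i a M i x).
apply: (@eq_Ck _ _ _ _ (fun x => w x * w x)) => //.
  by move=> x _; rewrite /w mulN1r.
have cw : Ck 0 U w.
  apply: CkD => //; first exact: Ck_partial.
  apply: CkM => //; first exact: Ck_cst.
  by apply: CkM => //; [exact: CkS|exact: Ck_field_i].
exact: CkM.
Qed.

(** The field u^2 grad phi / phi extends by zero to a C^1 field on the whole space, so its
    divergence integrates to 0. *)
Lemma hardy_identity a M u : (M <= n.+1)%N -> C0inf_half u ->
  iint (gradsq u) =
  \sum_(1 <= m < M.+1) hbeta a m * iint (fun x => u x ^+ 2 / rsq m x) +
  iint (excess a M u).
Proof.
move=> Mn [su [K [cK [KU u0]]]].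
have [B B0 KB] := compact_coord_bound cK.
have clK := compact_rV_closed cK; have oU := @open_halfspace R n.
have cu2 := smooth_Ck1 U su; have cu1 := CkS cu2.
have ucs f : (forall x, ~ K x -> f x = 0) -> Ck 0 U f -> unifcompsupp B f.
  by move=> f0 cf; apply: (unifcompsupp_halfspace cK KU KB f0 cf).
have p0 i x : ~ K x -> partial i u x = 0 by move=> Kx; exact: (partial_out i clK u0 Kx).
pose G i x := u x ^+ 2 * field_i a M i x.
have cG k i : (k <= 2)%N -> Ck k U u -> Ck k U (G i).
  move=> _ cu; apply: CkM => //; last exact: Ck_field_i.
  by apply: (@eq_Ck _ _ _ _ (fun x => u x * u x)) => //; exact: CkM.
have G0 i x : ~ K x -> G i x = 0 by move=> /u0; rewrite /G => ->; rewrite expr0n mul0r.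
have cG1 i : Ck 1 setT (G i) by apply: (Ck_extend oU clK KU (G0 i)); exact: cG.
have uG i : unifcompsupp B (G i) by apply: ucs => [x|]; [exact: G0|apply: cG => //; exact: CkS].
have upG i : unifcompsupp B (partial i (G i)).
  apply: ucs; first by move=> x Kx; exact: (partial_out i clK (G0 i) Kx).
  by have := cG 1%N i isT cu1; exact: Ck_partial.
have iG i : iint (partial i (G i)) = 0.
  by apply: (iint_partial B0 (uG i)) => // x; exact: Ck_derivable (cG1 i) I.
have uq m : (1 <= m < M.+1)%N -> unifcompsupp B (fun x => u x ^+ 2 / rsq m x).
  by move=> /andP[m1 _]; exact: (unifcompsupp_quot cK KU KB u0 su).
have uE : unifcompsupp B (excess a M u) by exact: (unifcompsupp_excess _ _ cK KU KB u0 su).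
(* The range of the sum is repeated as a filter so that 1 <= m is available when each term is shown
   to be continuous with compact support. *)
have E x : gradsq u x =
    \sum_(1 <= m < M.+1 | (1 <= m < M.+1)%N) hbeta a m * (u x ^+ 2 / rsq m x) +
    excess a M u x + \sum_i partial i (G i) x.
  have [Kx|Kx] := pselect (K x).
    by rewrite (gradsq_expand a (KU _ Kx) Mn cu1) [in LHS]big_nat.
  rewrite /gradsq /excess !big1 ?addr0 // => [i _|i _|m _|i _].
  - exact: (partial_out i clK (G0 i) Kx).
  - by rewrite p0 // u0 // mul0r subr0 expr0n.
  - by rewrite u0 // expr0n mul0r mulr0.
  - by rewrite p0 // expr0n.
have uS : unifcompsupp B (fun x =>
    \sum_(1 <= m < M.+1 | (1 <= m < M.+1)%N) hbeta a m * (u x ^+ 2 / rsq m x)).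
  by apply: unifcompsupp_sum => m /uq um; exact: unifcompsuppZ.
rewrite (eq_iint E) (iintD (unifcompsuppD uS uE)); last first.
  by apply: unifcompsupp_sum => i _.
rewrite (iint_sum _ (M := B)) // [X in _ + X]big1 // addr0 (iintD uS uE).
rewrite (iint_sum _ (M := B)) => [|m /uq um]; last exact: unifcompsuppZ.
rewrite [in RHS]big_nat; congr (_ + _); apply: eq_bigr => m /uq um.
exact: iintZ um.
Qed.

Lemma excess_ge0 a M u x : 0 <= excess a M u x.
Proof. by apply: sumr_ge0 => i _; exact: sqr_ge0. Qed.

Lemma iint_excess_ge0 a M u : C0inf_half u -> 0 <= iint (excess a M u).
Proof.
move=> [su [K [cK [KU u0]]]]; have [B B0 KB] := compact_coord_bound cK.
apply: (iint_ge0 B0); last exact: excess_ge0.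
exact: (unifcompsupp_excess _ _ cK KU KB u0 su).
Qed.

Lemma iint_quot_gt0 u m : (0 < m)%N -> C0inf_half u -> u <> (fun=> 0) ->
  0 < iint (fun x => u x ^+ 2 / rsq m x).
Proof.
move=> m0 [su [K [cK [KU u0]]]] uN; have [B B0 KB] := compact_coord_bound cK.
have [x /eqP ux] : exists x, u x <> 0.
  by apply/existsNP => H; apply: uN; apply/funext.
apply: (iint_gt0 (x := x) B0).
- exact: (unifcompsupp_quot cK KU KB u0 su).
- by move=> y; rewrite divr_ge0 ?sqr_ge0 ?rsq_ge0.
- have Ux : U x by apply: KU; apply: contrapT => /u0 /eqP; rewrite (negbTE ux).
  by rewrite divr_gt0 ?rsq_gt0 // lt_neqAle sqr_ge0 eq_sym sqrf_eq0 ux.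
Qed.

Lemma iint_potential (b : nat -> R) M u : C0inf_half u ->
  iint (fun x => (\sum_(1 <= m < M.+1) b m / rsq m x) * u x ^+ 2) =
  \sum_(1 <= m < M.+1) b m * iint (fun x => u x ^+ 2 / rsq m x).
Proof.
move=> [su [K [cK [KU u0]]]]; have [B B0 KB] := compact_coord_bound cK.
have uq m : (1 <= m < M.+1)%N -> unifcompsupp B (fun x => u x ^+ 2 / rsq m x).
  by move=> /andP[m1 _]; exact: (unifcompsupp_quot cK KU KB u0 su).
rewrite [RHS]big_nat.
under [RHS]eq_bigr => m /uq um do rewrite -(iintZ _ um).
rewrite -(iint_sum _ (M := B)) => [|m /uq um]; last exact: unifcompsuppZ.
apply: eq_iint => x; rewrite -big_nat mulr_suml; apply: eq_bigr => m _.
by rewrite -mulrA [_^-1 * _]mulrC.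
Qed.

End HardyIdentity.

(** * The truncated ground state *)

Section TestFunction.
Context {R : realType} {n : nat}.
Local Notation rV := 'rV[R]_n.+1.
Local Notation U := (@halfspace R n.+1).
Variables (k : nat) (a : nat -> R) (L : nat -> R).
Hypothesis L0 : forall j, 0 < L j.
Implicit Types (x : rV) (i j l : 'I_n.+1).

Definition logr (m : nat) x : R := ln (rsq m x).

(* For [1 <= j <= k], [sigma j x = ln (1 + s ^+ 2)] with [s = x_j / |X_j|], where
   coordinates are numbered from 0 and [|X_j|^2 = rsq j x]. *)
Definition sigma (j : 'I_n.+1) x : R :=
  if (j == 0 :> nat)%N then logr 1 x
  else if (j <= k)%N then logr j.+1 x - logr j x else x 0 j.

Definition phi x : R := expR (2^-1 * \sum_(1 <= m < k.+2) gexp a m * logr m x).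
Definition psi x : R := \prod_j eta (sigma j x / L j).
(** [phi] and [psi] see the first coordinate through its square only, so the product is even in it;
    the test keeps one of the two half-spaces. *)
Definition testfun x : R := if 0 < x 0 ord0 then phi x * psi x else 0.

(** For j <= k, x_j^2 <= |X_{k+1}|^2 = exp (sum of the first k + 1 [sigma]), and |x_j| <= 1 + x_j^2;
    for j > k, |x_j| <= L_j. The sum of the bounds covers both cases. *)
Definition sbound : R := 1 + expR (\sum_j L (j : 'I_n.+1)) + \sum_j L (j : 'I_n.+1).
Definition sbox : set rV := [set x | forall j,
  [set t : R | t \in `[(if (j == 0 :> nat)%N then expR (- L 0) else - sbound), sbound]]
    (x ord0 j)].

Lemma compact_sbox : compact sbox.
Proof.
apply: (@rV_compact _ _ (fun j : 'I_n.+1 => [set t : R |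
  t \in `[(if (j == 0 :> nat)%N then expR (- L 0) else - sbound), sbound]])) => j.
exact: segment_compact.
Qed.

Lemma sbox_halfspace : sbox `<=` U.
Proof.
move=> x Kx; apply/halfspaceE; have := Kx ord0; rewrite /= in_itv /= => /andP[+ _].
by apply: lt_le_trans; exact: expR_gt0.
Qed.

Lemma rsqS j x : rsq j.+1 x = rsq j x + x 0 j ^+ 2.
Proof.
rewrite /rsq (bigD1 j) //= addrC; congr (_ + _); apply: eq_bigl => l.
by rewrite ltnS ltn_neqAle andbC.
Qed.

Lemma rsq1 x : rsq 1 x = x 0 ord0 ^+ 2.
Proof. by rewrite (rsqS ord0) /rsq big_pred0 ?add0r. Qed.

Lemma logr1 x : U x -> logr 1 x = 2 * ln (x 0 ord0).
Proof. by move=> /halfspaceE x0; rewrite /logr rsq1 lnXn // mulr2n; ring. Qed.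

Lemma sum_sigma m x : (m <= k.+1)%N -> (m <= n.+1)%N ->
  \sum_(l < n.+1 | (l < m)%N) sigma l x = if m is 0 then 0 else logr m x.
Proof.
case: m => [|m]; first by rewrite big_pred0.
elim: m => [|m IH] mk mn.
  rewrite (big_pred1 ord0) // => l; rewrite ltnS leqn0.
  by apply/idP/idP => [/eqP h|/eqP ->//]; apply/eqP/val_inj.
rewrite (bigD1 (Ordinal mn)) //= (eq_bigl (fun l : 'I_n.+1 => (l < m.+1)%N)); last first.
  by move=> l; rewrite ltnS [RHS]ltn_neqAle andbC.
rewrite IH ?(ltnW mk) ?(ltnW mn) // /sigma /= -ltnS mk; ring.
Qed.

Lemma in_sbox x : (k < n.+1)%N -> U x -> (forall j, `|sigma j x| <= L j) -> sbox x.
Proof.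
move=> kn Ux sL; have x0 := (halfspaceE x).1 Ux.
have sb j : `|x 0 j| <= sbound.
  have eS : 0 <= expR (\sum_j L (j : 'I_n.+1)) by exact: expR_ge0.
  have S0 : 0 <= \sum_j L (j : 'I_n.+1) by apply: sumr_ge0 => l _; exact: ltW.
  have [jk|jk] := leqP j k; last first.
    have := sL j; rewrite /sigma -(ltn_predK jk) /= (ltn_predK jk) leqNgt jk /= => xL.
    apply: le_trans xL _; rewrite /sbound (bigD1 j) //=.
    have : 0 <= \sum_(i < n.+1 | i != j) L i by apply: sumr_ge0 => l _; exact: ltW.
    rewrite (bigD1 j) //= in eS; lra.
  have q0 : 0 < rsq k.+1 x by exact: rsq_gt0.
  have xq : x 0 j ^+ 2 <= rsq k.+1 x.
    by rewrite /rsq (bigD1 j) ?ltnS //= lerDl sumr_ge0 // => l _; exact: sqr_ge0.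
  have qS : rsq k.+1 x <= expR (\sum_j L (j : 'I_n.+1)).
    rewrite -[leLHS]lnK // ler_expR -/(logr k.+1 x).
    have <- := sum_sigma x (leqnn k.+1) kn.
    rewrite big_mkcond; apply: ler_sum => l _; case: ifP => _; last exact: ltW.
    by apply: le_trans (sL l); exact: ler_norm.
  have := sqr_ge0 (`|x 0 j| - 1); rewrite sqrrB1 real_normK ?num_real // /sbound.
  have := normr_ge0 (x 0 j); rewrite mulr2n; lra.
move=> j; rewrite /= in_itv /=; have := sb j; rewrite ler_norml => /andP[h1 h2].
rewrite h2 andbT; case: ifP => // /eqP j0.
have -> : j = ord0 by exact/val_inj.
have := sL ord0; rewrite /sigma /= logr1 // ler_norml => /andP[h _].
rewrite -[leRHS]lnK // ler_expR; have := L0 0; lra.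
Qed.

Lemma Ck_logr m r : (0 < m)%N -> Ck r U (logr m).
Proof.
move=> m0; have oU := @open_halfspace R n.
by apply: Ck_ln => // [x Ux|]; [exact: rsq_gt0|exact: Ck_rsq].
Qed.

Lemma CkB r (V : set rV) f g : open V -> Ck r V f -> Ck r V g -> Ck r V (fun x => f x - g x).
Proof.
move=> oV cf cg; apply: (@eq_Ck _ _ _ _ (fun x => f x + -1 * g x)) => //.
  by move=> y _; rewrite mulN1r.
by apply: CkD => //; apply: CkM => //; exact: Ck_cst.
Qed.

Lemma Ck_sigma r j : Ck r U (sigma j).
Proof.
have oU := @open_halfspace R n; rewrite /sigma.
have [_|j0] := eqVneq (j : nat) 0%N; first exact: Ck_logr.
have [_|_] := leqP j k; last exact: Ck_coord.
by apply: CkB => //; apply: Ck_logr => //; rewrite lt0n.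
Qed.

Lemma Ck_phi r : Ck r U phi.
Proof.
have oU := @open_halfspace R n; apply: Ck_expR => //; apply: CkM => //; first exact: Ck_cst.
under eq_fun do rewrite big_nat.
apply: Ck_sum => // m /andP[m1 _]; apply: CkM => //; [exact: Ck_cst|exact: Ck_logr].
Qed.

Lemma Ck_psi r : Ck r U psi.
Proof.
have oU := @open_halfspace R n; apply: Ck_prod => // j _; apply: Ck_eta => //.
by apply: CkM => //; [exact: Ck_sigma|exact: Ck_cst].
Qed.

Lemma testfunE x : U x -> testfun x = phi x * psi x.
Proof. by move=> /halfspaceE x0; rewrite /testfun x0. Qed.

Lemma Ck_testfun r : Ck r U testfun.
Proof.
have oU := @open_halfspace R n.
apply: (@eq_Ck _ _ _ _ (fun x => phi x * psi x)) => //.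
  by move=> x Ux; rewrite testfunE.
by apply: CkM => //; [exact: Ck_phi|exact: Ck_psi].
Qed.

Lemma testfun_out x : (k < n.+1)%N -> ~ sbox x -> testfun x = 0.
Proof.
move=> kn Kx; rewrite /testfun; case: ifP => // /halfspaceE Ux.
have : ~ forall j, `|sigma j x| <= L j by move=> /(in_sbox kn Ux).
move=> /existsNP[j /negP]; rewrite -ltNge => Lj.
rewrite /psi (bigD1 j) //= eta_out ?mul0r ?mulr0 //.
by rewrite normrM normfV (gtr0_norm (L0 j)) ler_pdivlMr // mul1r ltW.
Qed.

Lemma C0inf_testfun : (k < n.+1)%N -> C0inf_half testfun.
Proof.
move=> kn; split; last first.
  exists sbox; split; first exact: compact_sbox.
  by split; [exact: sbox_halfspace|move=> x; exact: testfun_out].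
apply: smooth_Ck => r.
apply: (Ck_extend (@open_halfspace R n) (compact_rV_closed compact_sbox) sbox_halfspace).
  by move=> x; exact: testfun_out.
exact: Ck_testfun.
Qed.

End TestFunction.

(** * Pointwise bound of the energy by single-layer terms *)

Section TestFunctionEnergy.
Context {R : realType} {n : nat}.
Local Notation rV := 'rV[R]_n.+1.
Local Notation U := (@halfspace R n.+1).
Local Notation I := (Rintegral (@lebesgue_measure R) setT).
Variables (k : nat) (a : nat -> R) (L : nat -> R).
Implicit Types (x : rV) (i j l : 'I_n.+1).
Local Notation sigma := (@sigma R n k).
Local Notation phi := (@phi R n k a).
Local Notation psi := (@psi R n k L).
Local Notation testfun := (@testfun R n k a L).

Lemma is_derive_bigprod (r : seq 'I_n.+1) (f : 'I_n.+1 -> rV -> R) (x v : rV)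
    (d : 'I_n.+1 -> R) : uniq r -> (forall t, is_derive x v (f t) (d t)) ->
  is_derive x v (fun y => \prod_(t <- r) f t y)
    (\sum_(t <- r) d t * \prod_(s <- r | s != t) f s x).
Proof.
move=> + df; elim: r => [_|t r IH /= /andP[tr ur]].
  by rewrite big_nil; under eq_fun do rewrite big_nil; exact: is_derive_cst.
under eq_fun do rewrite big_cons.
have h1 := df t; have h2 := IH ur.
have := is_deriveM h1 h2; congr (is_derive _ _ _ _).
rewrite big_cons big_cons eqxx /= /GRing.scale /= addrC mulrC; congr (_ * _ + _).
  rewrite [RHS]big_seq_cond big_seq; apply: eq_bigl => s; apply/idP/idP => [sr|/andP[]//].
  by rewrite sr; apply: contraNneq tr => <-.
rewrite mulr_sumr big_seq [RHS]big_seq; apply: eq_bigr => s sr; rewrite big_cons.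
have -> : t != s by apply: contraNneq tr => ->.
by rewrite mulrCA.
Qed.

(** The radius whose inverse square controls the squared gradient of [sigma j]; index 0 stands for
    the constant weight 1, for the coordinates beyond [k]. *)
Definition tau (j : 'I_n.+1) : nat :=
  (if j == 0 :> nat then 1 else if j <= k then j : nat else 0)%N.
Definition invrsq (m : nat) x : R := if m is 0 then 1 else (rsq m x)^-1.

Lemma is_derive_logr m i x : U x -> (0 < m)%N ->
  is_derive x (delta_mx 0 i) (logr m) (2 * radial m i x).
Proof.
move=> Ux m0; have q0 := rsq_gt0 Ux m0.
have := is_derive_comp_dir (is_derive1_ln q0) (is_derive_rsq m i x).
by congr (is_derive _ _ _ _); rewrite /radial; ring.
Qed.

(** For 1 <= j <= k the cross term is explicit by [sum_radialM], and the squared gradient equals 4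
    (1/|X_j|^2 - 1/|X_{j+1}|^2). *)
Lemma sigma_grad j x : U x -> exists2 d : 'I_n.+1 -> R,
  forall i, is_derive x (delta_mx 0 i) (sigma j) (d i) &
  \sum_i d i ^+ 2 <= 4 * invrsq (tau j) x.
Proof.
move=> Ux; rewrite /tau /sigma.
have [j0|j0] := eqVneq (j : nat) 0%N.
  exists (fun i => 2 * radial 1 i x) => [i|]; first exact: is_derive_logr.
  under eq_bigr do rewrite exprMn expr2.
  by rewrite -mulr_sumr sum_radialM //= -natrM.
have [jk|jk] := leqP j k.
  rewrite -lt0n in j0.
  exists (fun i => 2 * radial j.+1 i x - 2 * radial j i x) => [i|].
    have h1 := is_derive_logr i Ux (ltn0Sn j); have h2 := is_derive_logr i Ux j0.
    exact: is_deriveB.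
  have E i : (2 * radial j.+1 i x - 2 * radial j i x) ^+ 2 =
    4 * (radial j.+1 i x * radial j.+1 i x) + 4 * (radial j i x * radial j i x)
    - 8 * (radial j i x * radial j.+1 i x) by ring.
  under eq_bigr do rewrite E.
  rewrite sumrB big_split /= -!mulr_sumr !sum_radialM //.
  have q1 : 0 < (rsq j.+1 x)^-1 by rewrite invr_gt0 rsq_gt0.
  by rewrite -(prednK j0) /= (prednK j0); lra.
exists (fun i => (j == i)%:R) => [i|]; first exact: is_derive_coord.
rewrite (bigD1 j) //= big1 ?eqxx ?expr1n => [|i]; first by lra.
by rewrite eq_sym => /negbTE ->; rewrite expr0n.
Qed.

(** Cauchy-Schwarz, read off the nonnegative double sum of (c_s - c_t)^2. *)
Lemma sqr_sum_le (T : finType) (c : T -> R) :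
  (\sum_t c t) ^+ 2 <= #|T|%:R * \sum_t c t ^+ 2.
Proof.
have : 0 <= \sum_s \sum_t (c s - c t) ^+ 2.
  by apply: sumr_ge0 => s _; apply: sumr_ge0 => t _; exact: sqr_ge0.
have E s : \sum_t (c s - c t) ^+ 2 =
    #|T|%:R * c s ^+ 2 - 2 * c s * \sum_t c t + \sum_t c t ^+ 2.
  rewrite mulr_natl -sumr_const mulr_sumr -sumrB -big_split /=.
  by apply: eq_bigr => t _; ring.
under eq_bigr do rewrite E.
rewrite big_split sumrB /= -mulr_sumr -mulr_suml -mulr_sumr sumr_const -mulr_natl.
by lra.
Qed.

Definition slope_at j l : R -> R := if l == j then cutoff_slope (L l) else cutoff (L l).

Definition weighted m (P : 'I_n.+1 -> R -> R) x : R :=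
  if 0 < x 0 ord0 then phi x ^+ 2 * invrsq m x * \prod_l P l (sigma l x) else 0.

Lemma is_derive_phi i x : U x ->
  is_derive x (delta_mx 0 i) phi (phi x * field_i a k.+1 i x).
Proof.
move=> Ux; apply: is_derive_comp_dir.
have -> : field_i a k.+1 i x =
    2^-1 * \sum_(1 <= m < k.+2 | (1 <= m < k.+2)%N) gexp a m * (2 * radial m i x).
  rewrite /field_i big_nat mulr_sumr; apply: eq_bigr => m _.
  by field.
under eq_fun do rewrite big_nat.
have h := @is_derive_bigsum R n _ (index_iota 1 k.+2) (fun m => (1 <= m < k.+2)%N)
  (fun m y => gexp a m * logr m y) x (delta_mx 0 i) (fun m => gexp a m * (2 * radial m i x)).
apply: (@is_deriveZ R _ _ _ 2^-1); apply: h => m /andP[m1 _].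
have h := is_derive_logr i Ux m1.
exact: (@is_deriveZ R _ _ _ (gexp a m)).
Qed.

(** The derivative falling on [phi] cancels against the field. Cauchy-Schwarz over the [n.+1]
    factors of [psi] then separates the layers, so that no inner product of gradients of different
    [sigma] has to be computed. *)
Lemma excess_testfun x : U x ->
  excess a k.+1 testfun x <= n.+1%:R * \sum_j weighted (tau j) (slope_at j) x.
Proof.
move=> Ux; have x0 := (halfspaceE x).1 Ux.
have oU := @open_halfspace R n.
have [d dE dS] : exists2 d : 'I_n.+1 -> 'I_n.+1 -> R,
    forall j i, is_derive x (delta_mx 0 i) (sigma j) (d j i) &
    forall j, \sum_i d j i ^+ 2 <= 4 * invrsq (tau j) x.
  pose D j := cid2 (sigma_grad j Ux).
  exists (fun j => s2val (D j)) => j; first exact: s2valP (D j).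
  exact: s2valP' (D j).
pose Z j := eta (sigma j x / L j); pose Z' j := eta' (sigma j x / L j) / L j.
pose c i j := Z' j * d j i * \prod_(l | l != j) Z l.
have E i : partial i testfun x - testfun x * field_i a k.+1 i x = phi x * \sum_j c i j.
  have hZ j : is_derive x (delta_mx 0 i) (fun y => eta (sigma j y / L j)) (Z' j * d j i).
    have h1 : is_derive x (delta_mx 0 i) (fun y => sigma j y / L j) ((L j)^-1 * d j i).
      have h := dE j i; have := @is_deriveZ R _ _ _ (L j)^-1 x (delta_mx 0 i) _ h.
      by congr (is_derive _ _ _ _); apply/funext => y; rewrite mulrC.
    have := @is_derive_comp_dir R _ eta (fun y => sigma j y / L j) x _ _ _
      (is_derive_eta (sigma j x / L j)) h1.
    by congr (is_derive _ _ _ _); rewrite /Z' mulrA.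
  have hpsi : is_derive x (delta_mx 0 i) psi (\sum_j c i j).
    exact: is_derive_bigprod (index_enum_uniq _) hZ.
  have hphi := is_derive_phi i Ux.
  rewrite (eq_partial (g := fun y => phi y * psi y) i oU Ux) => [|y Uy]; last first.
    by rewrite testfunE.
  rewrite testfunE //.
  have [_ e] := is_deriveM hphi hpsi.
  rewrite [partial _ _ _]e /GRing.scale /=; ring.
rewrite /excess; under eq_bigr do rewrite E exprMn.
rewrite -mulr_sumr.
apply: (@le_trans _ _ (phi x ^+ 2 * (n.+1%:R * \sum_i \sum_j c i j ^+ 2))).
  apply: ler_wpM2l; first exact: sqr_ge0.
  rewrite mulr_sumr; apply: ler_sum => i _.
  by have := sqr_sum_le (c i); rewrite card_ord.
rewrite mulrCA; apply: ler_wpM2l; first by rewrite ler0n.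
rewrite exchange_big mulr_sumr; apply: ler_sum => j _.
rewrite /weighted x0 -mulrA; apply: ler_wpM2l; first exact: sqr_ge0.
have -> : \sum_i c i j ^+ 2 =
    (\sum_i d j i ^+ 2) * (Z' j ^+ 2 * (\prod_(l | l != j) Z l) ^+ 2).
  by rewrite mulr_suml; apply: eq_bigr => i _; rewrite /c; ring.
have -> : \prod_l slope_at j l (sigma l x) =
    4 * (Z' j ^+ 2 * (\prod_(l | l != j) Z l) ^+ 2).
  rewrite (bigD1 j) //= {1}/slope_at eqxx /cutoff_slope -prodrXl.
  rewrite (eq_bigr (fun l => Z l ^+ 2)) => [|l /negbTE lj]; last by rewrite /slope_at lj.
  by rewrite /Z' expr_div_n; ring.
rewrite [leRHS]mulrA [in leRHS](mulrC _ 4); apply: ler_wpM2r; last exact: dS.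
by rewrite mulr_ge0 // sqr_ge0.
Qed.

End TestFunctionEnergy.

(** * Factorisation of the weighted integrals into layers *)

Section TestFunctionIntegrals.
Context {R : realType} {n : nat}.
Local Notation rV := 'rV[R]_n.+1.
Local Notation U := (@halfspace R n.+1).
Local Notation I := (Rintegral (@lebesgue_measure R) setT).
Variables (k : nat) (a : nat -> R) (L : nat -> R).
Hypotheses (L0 : forall j, 0 < L j) (kn : (k < n.+1)%N) (a0 : a k.+1 = 0) (k0 : (0 < k)%N).
Implicit Types (x : rV) (i j l : 'I_n.+1) (P : 'I_n.+1 -> R -> R).
Local Notation sigma := (@sigma R n k).
Local Notation phi := (@phi R n k a).
Local Notation testfun := (@testfun R n k a L).
Local Notation weighted := (@weighted R n k a).

(** The flag [c] tells whether the factor 1/|X_m|^2 reaches layer [l], which happens exactly when l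
    < m; it lowers the exponent by 1. *)
Definition layer l (c : bool) (p : R -> R) : R -> R :=
  if (l == 0 :> nat)%N then log_layer c%:R p
  else if (l <= k)%N then power_layer (a l - 2^-1 - c%:R) p else p.

(* The value 1 at [rsq l x = 0] keeps [rho] positive off the half-space, where
   every integrand vanishes anyway. *)
Definition rho l x : R :=
  if (0 < l <= k)%N then (if rsq l x == 0 then 1 else Num.sqrt (rsq l x)) else 1.

(** The exponent of phi^2 regrouped by layer instead of by radius; the term -1/2 [logr l] is the
    Jacobian factor 1/|X_l|. *)
Definition log_weight x (l : nat) : R :=
  if l is 0 then 2^-1 * logr 1 x
  else if (l <= k)%N then (a l - 2^-1) * (logr l.+1 x - logr l x) - 2^-1 * logr l x else 0.

Lemma rho_gt0 l x : 0 < rho l x.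
Proof.
rewrite /rho; case: ifP => // _; case: eqP => // /eqP q0.
by rewrite sqrtr_gt0 lt_neqAle eq_sym q0 rsq_ge0.
Qed.

Lemma rho_local l (x y : rV) : (forall i, (i < l)%N -> x 0 i = y 0 i) -> rho l x = rho l y.
Proof.
move=> xy; suff E : rsq l x = rsq l y by rewrite /rho E.
by rewrite /rsq; apply: eq_bigr => i /xy ->.
Qed.

Lemma rhoE l x : U x -> (0 < l <= k)%N -> rho l x = expR (2^-1 * logr l x).
Proof.
move=> Ux lk; have q0 : 0 < rsq l x by apply: rsq_gt0 => //; case/andP: lk.
rewrite /rho lk gt_eqF //; apply: (@pexpIrn _ 2) => //.
- by rewrite nnegrE sqrtr_ge0.
- by rewrite nnegrE expR_ge0.
by rewrite sqr_sqrtr ?(ltW q0) // -expRM_natl mulrA mulfV // mul1r lnK.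
Qed.

Lemma sum_log_weight x : \sum_(l < n.+1) log_weight x l =
  \sum_(1 <= m < k.+2) gexp a m * logr m x.
Proof.
transitivity (\sum_(0 <= l < k.+1) log_weight x l).
  rewrite -(big_mkord xpredT) (big_cat_nat (n := k.+1)) //= [X in _ + X]big_nat.
  rewrite [X in _ + X]big1 ?addr0 // => l /andP[kl _].
  by rewrite /log_weight -(ltn_predK kl) /= (ltn_predK kl) leqNgt kl.
rewrite [RHS]big_nat_recr //= {2}/gexp eqSS (gtn_eqF k0) a0 subr0.
(* Summation by parts: the partial sums leave one boundary term, which at q = k is the last exponent
   because [a k.+1 = 0]. *)
have : forall q, (0 < q <= k)%N -> \sum_(0 <= l < q.+1) log_weight x l =
    \sum_(1 <= m < q.+1) gexp a m * logr m x + (a q - 2^-1) * logr q.+1 x.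
  elim=> // -[|q] IH /= qk.
    rewrite big_nat_recr //= big_nat1 big_nat1 /gexp eqxx /= qk; ring.
  rewrite big_nat_recr // IH /= ?(ltnW qk) // [in RHS]big_nat_recr //= /gexp /= qk; ring.
by move=> /(_ k); rewrite k0 leqnn => ->.
Qed.

Lemma layerE l (c : bool) p x : U x -> (c -> (l <= k)%N) ->
  layer l c p (x 0 l / rho l x) / rho l x =
  expR (log_weight x l - c%:R * sigma l x) * p (sigma l x).
Proof.
move=> Ux cl; have x0 := (halfspaceE x).1 Ux.
rewrite /layer /log_weight /sigma.
have [l0|l0] := eqVneq (l : nat) 0%N.
  have -> : l = ord0 by exact/val_inj.
  rewrite /rho /= !divr1 /log_layer x0 -rsq1 -/(logr 1 x).
  by congr (expR _ * _); ring.
rewrite -lt0n in l0.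
have E : log_weight x l = if (l <= k)%N then
    (a l - 2^-1) * (logr l.+1 x - logr l x) - 2^-1 * logr l x else 0.
  by rewrite /log_weight -(prednK l0).
rewrite -/(log_weight x l) E; have [lk|lk] := leqP l k; last first.
  rewrite /rho [(l <= k)%N]leqNgt lk andbF !divr1.
  by case: c cl => [/(_ isT)|_]; [rewrite leqNgt lk|rewrite mul0r subr0 expR0 mul1r].
have q0 : 0 < rsq l x by exact: rsq_gt0.
have q1 : 0 < rsq l.+1 x by exact: rsq_gt0.
have r2 : rho l x ^+ 2 = rsq l x.
  by rewrite rhoE ?l0 // -expRM_natl mulrA mulfV // mul1r lnK.
have Es : ln (1 + (x 0 l / rho l x) ^+ 2) = logr l.+1 x - logr l x.
  rewrite expr_div_n r2 -ln_div ?posrE // rsqS; congr ln.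
  by field; rewrite gt_eqF.
rewrite /power_layer Es mulrAC rhoE ?l0 // -expRN -expRD.
by congr (expR _ * _); ring.
Qed.

(** Since ln |X_m|^2 telescopes into the first m values of [sigma], the factor 1/|X_m|^2 splits over
    the layers l < m. *)
Lemma weighted_layers m P x : (m <= k.+1)%N ->
  weighted m P x = 1 * \prod_l (layer l (l < m)%N (P l) (x 0 l / rho l x) / rho l x).
Proof.
move=> mk; rewrite mul1r /weighted; case: ifP => [x0|/negP x0]; last first.
  (* Off the half-space the product vanishes too, its first factor being a [log_layer] at a
     nonpositive argument. *)
  rewrite (bigD1 ord0) //= /layer /= /log_layer ifF ?mul0r //.
  by apply/negP; rewrite /rho /= divr1.
have Ux := (halfspaceE x).2 x0.
rewrite [RHS](eq_bigr (fun l => expR (log_weight x l - (l < m)%N%:R * sigma l x) *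
  P l (sigma l x))) => [|l _]; last first.
  by apply: layerE => // lm; rewrite -ltnS (leq_trans lm).
rewrite big_split /= -expR_sum sumrB sum_log_weight; congr (_ * _).
rewrite expRB /phi -expRM_natl mulrA mulfV // mul1r; congr (_ * _).
have -> : \sum_(l < n.+1) (l < m)%N%:R * sigma l x = \sum_(l < n.+1 | (l < m)%N) sigma l x.
  rewrite [RHS]big_mkcond; apply: eq_bigr => l _.
  by case: ifP => _; rewrite ?mul1r ?mul0r.
rewrite sum_sigma // ?(leq_trans mk kn) //.
case: m mk => [|m] mk /=; first by rewrite expR0 invr1.
by rewrite lnK // posrE rsq_gt0.
Qed.

Lemma compsupp_layer l c p : compsupp (L l) p ->
  compsupp (Num.max (expR (L l)) (L l)) (layer l c p).
Proof.
move=> cp; rewrite /layer; case: ifP => _.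
  apply: compsuppW (compsupp_log_layer _ (ltW (L0 l)) cp); by rewrite le_max lexx.
case: ifP => _.
  by apply: compsuppW (compsupp_power_layer _ cp); rewrite le_max lexx.
by apply: compsuppW cp; rewrite le_max lexx orbT.
Qed.

Lemma iint_weighted m P : (m <= k.+1)%N -> (forall l, compsupp (L l) (P l)) ->
  iint (weighted m P) = \prod_l I (layer l (l < m)%N (P l)).
Proof.
move=> mk cP; rewrite -[RHS]mul1r (eq_iint (fun x => weighted_layers P x mk)).
apply: (iint_triangular (M := fun l => Num.max (expR (L l)) (L l))).
- exact: rho_gt0.
- exact: rho_local.
- by move=> l; exact: compsupp_layer.
Qed.

Lemma unifcompsupp_weighted m P : (forall l, compsupp (L l) (P l)) ->
  unifcompsupp (sbound L (n := n)) (weighted m P).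
Proof.
move=> cP; have oU := @open_halfspace R n.
have clK := compact_rV_closed (@compact_sbox R n L).
have W0 x : ~ sbox L x -> weighted m P x = 0.
  move=> Kx; rewrite /weighted; case: ifP => // /halfspaceE Ux.
  have : ~ forall j, `|sigma j x| <= L j by move=> /(in_sbox L0 kn Ux).
  move=> /existsNP[j /negP]; rewrite -ltNge => Lj.
  by rewrite (bigD1 j) //= (cP j).2 // mul0r mulr0.
apply: (unifcompsupp_halfspace (@compact_sbox R n L) (@sbox_halfspace R n L)) => //.
  move=> x j /(_ j); rewrite /= in_itv /= => /andP[h1 h2]; rewrite ler_norml h2 andbT.
  apply: le_trans h1; case: ifP => // _; rewrite lerNl.
  have S0 : 0 <= \sum_j L (j : 'I_n.+1) by apply: sumr_ge0 => l _; exact: ltW.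
  have := expR_ge0 (\sum_j L (j : 'I_n.+1)); have := expR_ge0 (- L 0).
  by rewrite /sbound; lra.
apply: (@eq_Ck _ _ _ _ (fun x => phi x * phi x * invrsq m x * \prod_l P l (sigma l x))) => //.
  by move=> x /halfspaceE x0; rewrite /weighted x0 expr2.
apply: CkM => //.
  apply: CkM => //; first by apply: CkM => //; exact: Ck_phi.
  case: m {W0} => [|m]; first exact: Ck_cst.
  by apply: Ck_inv => // [x Ux|]; [exact: rsq_gt0|exact: Ck_rsq].
apply: Ck_prod => // l _ x Ux.
exact: (continuous_comp (Ck_cont (Ck_sigma k 0 l) Ux) ((cP l).1 _)).
Qed.

Lemma testfun_sqr x : U x -> testfun x ^+ 2 / rsq k.+1 x =
  weighted k.+1 (fun l => cutoff (L l)) x.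
Proof.
move=> Ux; rewrite testfunE // /weighted ((halfspaceE x).1 Ux) exprMn mulrAC /=.
by congr (_ * _); rewrite /psi -prodrXl.
Qed.

End TestFunctionIntegrals.

(** * Choosing all scales in dependency order *)

Section ScaleSelection.
Context {R : realType} {n : nat}.
Variables (k : nat) (S D ratio : 'I_n.+1 -> R -> R).
Hypotheses (kn : (k < n.+1)%N) (ratio_gt0 : forall l t, 0 < t -> 0 < ratio l t)
  (ex_scale : forall j e, 0 < e -> exists2 t, 1 <= t & S j t <= e * D j t).
Implicit Types (j l : 'I_n.+1) (t e : R).

(* The scale of layer [j] may depend on those of the layers in [later j]: the
   scales are fixed in the order k, k-1, ..., 0, then k+1, k+2, ... *)
Definition later j l : bool := if (j <= k)%N then (j < l <= k)%N else (l <= k)%N.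

Lemma ex_scales_desc e (i : nat) : 0 < e -> (i <= k.+1)%N ->
  exists L : nat -> R, (forall m, 1 <= L m) /\
    forall j, (k.+1 - i <= j <= k)%N ->
      S j (L j) * \prod_(l | later j l) ratio l (L l) <= e * D j (L j).
Proof.
move=> e0; elim: i => [_|i IH ik].
  exists (fun=> 1); split=> // j /andP[h1 h2].
  by move: (leq_trans h1 h2); rewrite subn0 ltnn.
have [L [L1 HL]] := IH (ltnW ik).
have pk : (k - i < n.+1)%N by apply: leq_ltn_trans kn; exact: leq_subr.
pose p := Ordinal pk.
have q0 : 0 < \prod_(l | later p l) ratio l (L l).
  by apply: prodr_gt0 => l _; apply: ratio_gt0; apply: lt_le_trans (L1 l).
(* The tolerance is divided by the product of the ratios of the scales already fixed. *)
have [t t1 Ht] := ex_scale p (divr_gt0 e0 q0).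
exists (fun m => if m == (k - i)%N then t else L m); split=> [m|j].
  by case: ifP.
rewrite subSS => /andP[pj jk].
(* Resetting the scale at k - i disturbs none of these products: they involve only indices above j
   >= k - i. *)
have E : \prod_(l | later j l) ratio l (if (l : nat) == (k - i)%N then t else L l) =
    \prod_(l | later j l) ratio l (L l).
  apply: eq_bigr => l; rewrite /later jk => /andP[jl _].
  by rewrite gtn_eqF // (leq_ltn_trans pj).
rewrite E; move: pj; rewrite leq_eqVlt eq_sym => /orP[/eqP jp|pj].
  have -> : j = p by exact/val_inj.
  by rewrite /= eqxx -ler_pdivlMr // mulrAC.
by rewrite gtn_eqF //; apply: HL; rewrite jk andbT subSn.
Qed.

Lemma ex_scales e : 0 < e -> exists L : nat -> R, (forall m, 1 <= L m) /\
  forall j, S j (L j) * \prod_(l | later j l) ratio l (L l) <= e * D j (L j).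
Proof.
move=> e0; have [L [L1 HL]] := ex_scales_desc e0 (leqnn k.+1).
pose q := \prod_(l < n.+1 | (l <= k)%N) ratio l (L l).
have q0 : 0 < q.
  by apply: prodr_gt0 => l _; apply: ratio_gt0; apply: lt_le_trans (L1 l).
have [T T1 HT] : exists2 T : 'I_n.+1 -> R, forall j, 1 <= T j &
    forall j, S j (T j) <= e / q * D j (T j).
  pose T j := cid2 (ex_scale j (divr_gt0 e0 q0)).
  by exists (fun j => s2val (T j)) => j; [exact: s2valP (T j)|exact: s2valP' (T j)].
(* The coordinates beyond [k] come last: each depends on all layers up to [k] through [q], and on no
   other coordinate beyond [k]. *)
exists (fun m => if (m <= k)%N then L m else T (inord m)); split=> [m|j].
  by case: ifP.
have E : \prod_(l | later j l) ratio l (if (l <= k)%N then L l else T (inord l)) =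
    \prod_(l | later j l) ratio l (L l).
  apply: eq_bigr => l; rewrite /later; case: ifP => _ lk; last by rewrite lk.
  by case/andP: lk => _ ->.
rewrite E; have [jk|jk] := leqP j k.
  by apply: HL; rewrite subnn jk.
rewrite inord_val.
have -> : \prod_(l | later j l) ratio l (L l) = q.
  by apply: eq_bigl => l; rewrite /later leqNgt jk.
by rewrite -ler_pdivlMr // mulrAC.
Qed.

End ScaleSelection.

(** * A test function whose excess is arbitrarily small *)

Section Scales.
Context {R : realType} {n : nat}.
Local Notation I := (Rintegral (@lebesgue_measure R) setT).
Variables (k : nat) (a : nat -> R).
Hypotheses (kn : (k < n.+1)%N) (k0 : (0 < k)%N) (a_le0 : forall m, a m <= 0).
Implicit Types (j l : 'I_n.+1) (t e : R).

Definition mass (c : bool) l t : R := I (layer k a l c (cutoff t)).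
Definition slope_mass j t : R := I (layer k a j (j < tau k j)%N (cutoff_slope t)).

Lemma mass_gt0 c l t : 0 < t -> 0 < mass c l t.
Proof.
move=> t0; rewrite /mass /layer; case: ifP => _; first exact: log_layer_gt0.
by case: ifP => _; [exact: power_layer_gt0|exact: cutoff_gt0].
Qed.

(** The sign condition enters here: [a j <= 0] puts the exponent [a j - 1/2] within the range of
    [ex_power_layer]. *)
Lemma ex_scale j e : 0 < e ->
  exists2 t, 1 <= t & slope_mass j t <= e * mass (j < k.+1)%N j t.
Proof.
move=> e0; rewrite /slope_mass /mass /layer /tau.
have [->|j0] := eqVneq (j : nat) 0%N; first exact: ex_log_layer.
rewrite ltnS; have [jk|jk] := leqP j k; last exact: ex_cutoff.
rewrite ltnn subr0; apply: ex_power_layer; last exact: e0.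
by rewrite -[leRHS]add0r lerD2r.
Qed.

(** Compares numerator and denominator away from layer j: the flags agree except in the later
    layers, where 1/|X_{k+1}|^2 acts and the gradient weight does not. *)
Lemma tau_leP j l : l != j -> (l < tau k j)%N = (l < k.+1)%N && ~~ later k j l.
Proof.
move=> lj; rewrite /later /tau ltnS.
have [j0|j0] := eqVneq (j : nat) 0%N.
  have l0 : (0 < l)%N.
    by rewrite lt0n; apply: contra lj => /eqP l0; apply/eqP/val_inj; rewrite /= l0 j0.
  by rewrite j0 /= l0 /= andbN ltnS leqn0 gtn_eqF.
have [jk|jk] := leqP j k; last by rewrite andbN.
have [lt|gt|/val_inj e] := ltngtP l j; last by rewrite e eqxx in lj.
- by rewrite (leq_trans (ltnW lt) jk).
- by rewrite andbN.
Qed.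

(** Dividing layer by layer, each later layer leaves the ratio of its two masses, the remaining ones
    cancel, and layer j is the hypothesis. *)
Lemma slope_product_le e (L : nat -> R) j : (forall m, 1 <= L m) ->
  slope_mass j (L j) * \prod_(l | later k j l) (mass false l (L l) / mass true l (L l)) <=
    e * mass (j < k.+1)%N j (L j) ->
  \prod_(l < n.+1) I (layer k a l (l < tau k j)%N (slope_at L j l)) <=
  e * \prod_(l < n.+1) I (layer k a l (l < k.+1)%N (cutoff (L l))).
Proof.
move=> L1 H; have Lp m : 0 < L m by apply: lt_le_trans (L1 m).
rewrite (bigD1 j) //= [in leRHS](bigD1 j) //= {1}/slope_at eqxx -/(slope_mass j (L j)).
have jj : ~~ later k j j by rewrite /later; case: ifP; rewrite ?ltnn // => ->.
have -> : \prod_(l | l != j) I (layer k a l (l < tau k j)%N (slope_at L j l)) =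
    \prod_(l | l != j) (mass (l < k.+1)%N l (L l) *
      (if later k j l then mass false l (L l) / mass true l (L l) else 1)).
  apply: eq_bigr => l lj; rewrite /slope_at (negbTE lj) tau_leP // -/(mass _ l (L l)).
  case: ifP => [jl|_]; last by rewrite andbT mulr1.
  have -> : (l < k.+1)%N by move: jl; rewrite /later ltnS; case: ifP => // _ /andP[].
  rewrite [true && _]andbF mulrC; apply/esym; apply: divfK.
  exact: lt0r_neq0 (mass_gt0 true l (Lp l)).
rewrite big_split /= -big_mkcondr /= [X in _ * (_ * X)](eq_bigl (later k j)) => [|l]; last first.
  by have [->|lj] := eqVneq l j; rewrite ?(negbTE jj).
move: H; set A := \prod_(l | l != j) _.
have A0 : 0 <= A by apply: prodr_ge0 => l _; apply: ltW; apply: mass_gt0.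
rewrite -/(mass _ j (L j)); move: (slope_mass _ _) (\prod_(l | later k j l) _) (mass _ _ _).
move=> s p d H; rewrite mulrCA [e * _]mulrA mulrC; exact: ler_wpM2r.
Qed.

Lemma ex_testfun e : a k.+1 = 0 -> 0 < e -> exists u : 'rV[R]_n.+1 -> R,
  [/\ C0inf_half u, u <> (fun=> 0) &
    iint (excess a k.+1 u) <= e * iint (fun x => u x ^+ 2 / rsq k.+1 x)].
Proof.
move=> a0 e0; pose N : R := n.+1%:R; have N0 : 0 < N by rewrite ltr0n.
(* One factor [N] pays for Cauchy-Schwarz in [excess_testfun], the other for the sum over the [N]
   layers. *)
have d0 : 0 < e / (N * N) by rewrite divr_gt0 // mulr_gt0.
have [L [L1 HL]] := @ex_scales R n k slope_mass (fun j => mass (j < k.+1)%N j)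
  (fun l t => mass false l t / mass true l t) kn
  (fun l t h => divr_gt0 (mass_gt0 false l h) (mass_gt0 true l h)) ex_scale _ d0.
have Lp m : 0 < L m by apply: lt_le_trans (L1 m).
pose u := @testfun R n k a L; exists u.
have oU := @open_halfspace R n.
have uC : C0inf_half u by exact: C0inf_testfun.
have cc l : compsupp (L l) (cutoff (L l)) by exact: compsupp_cutoff.
have cs j l : compsupp (L l) (slope_at L j l).
  by rewrite /slope_at; case: ifP => _; [exact: compsupp_cutoff_slope|exact: cc].
have uE x : u x ^+ 2 / rsq k.+1 x = weighted k a k.+1 (fun l : 'I_n.+1 => cutoff (L l)) x.
  have [Ux|Ux] := pselect (@halfspace R n.+1 x); first exact: testfun_sqr.
  have x0 : (0 < x 0 ord0) = false by apply/negP => /halfspaceE.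
  by rewrite /u /testfun /weighted x0 expr0n mul0r.
have DE : iint (fun x => u x ^+ 2 / rsq k.+1 x) =
    \prod_(l < n.+1) I (layer k a l (l < k.+1)%N (cutoff (L l))).
  by rewrite (eq_iint uE); apply: (iint_weighted Lp kn a0 k0) => //.
have D0 : 0 < iint (fun x => u x ^+ 2 / rsq k.+1 x).
  by rewrite DE; apply: prodr_gt0 => l _; exact: mass_gt0.
split=> //.
  move=> u0; move: D0; rewrite (eq_iint (g := fun=> 0)) ?iint0 ?ltxx // => x.
  by rewrite u0 expr0n mul0r.
have [su [K [cK [KU uK]]]] := uC.
have [B B0 KB] := compact_coord_bound cK.
have uX : unifcompsupp B (excess a k.+1 u) by exact: (unifcompsupp_excess _ _ cK KU KB uK su).
pose B' := Num.max B `|sbound L (n := n)|.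
have uW j : unifcompsupp B' (weighted k a (tau k j) (slope_at L j)).
  apply: unifcompsuppW (unifcompsupp_weighted a Lp kn _ (cs j)).
  by rewrite le_max ler_norm orbT.
have B'0 : 0 <= B' by rewrite le_max B0.
apply: (@le_trans _ _ (iint (fun x => N * \sum_j weighted k a (tau k j) (slope_at L j) x))).
  apply: (iint_le B'0).
  - by apply: unifcompsuppW uX; rewrite le_max lexx.
  - by apply: unifcompsuppZ; apply: unifcompsupp_sum => j _.
  - move=> x; have [Ux|Ux] := pselect (@halfspace R n.+1 x); first exact: excess_testfun.
    have x0 : (0 < x 0 ord0) = false by apply/negP => /halfspaceE.
    have Kx : ~ K x by move=> /KU.
    rewrite /excess !big1 ?mulr0 // => [j _|j _]; first by rewrite /weighted x0.
    by rewrite (partial_out j (compact_rV_closed cK) uK Kx) uK // mul0r subr0 expr0n.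
rewrite (iintZ (M := B')); last by apply: unifcompsupp_sum => j _.
rewrite (iint_sum _ (M := B')) // mulr_sumr.
have tk j : (tau k j <= k.+1)%N by rewrite /tau; case: ifP => // _; case: ifP => // jk; exact: leqW.
have H j : N * iint (weighted k a (tau k j) (slope_at L j)) <=
    e / N * iint (fun x => u x ^+ 2 / rsq k.+1 x).
  rewrite (iint_weighted Lp kn a0 k0 (tk j) (cs j)) DE.
  have := slope_product_le L1 (HL j); rewrite -(ler_pM2l N0) => /le_trans; apply.
  rewrite mulrA; apply: ler_wpM2r.
    by apply: prodr_ge0 => l _; apply: ltW; exact: mass_gt0.
  by rewrite le_eqVlt; apply/orP; left; apply/eqP; field; rewrite gt_eqF.
apply: (le_trans (ler_sum _ (fun j _ => H j))).
rewrite sumr_const card_ord -mulr_natl -/N mulrA.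
apply: ler_wpM2r; first exact: ltW.
by rewrite le_eqVlt; apply/orP; left; apply/eqP; field; rewrite gt_eqF.
Qed.

End Scales.

(** * Optimality of the constant and the value of the infimum *)

Section SharpConstant.
Context {R : realType} {n : nat}.
Variables (k : nat) (alpha : nat -> R).
Hypotheses (kn : (k < n.+1)%N) (k0 : (0 < k)%N)
  (alpha_le0 : forall m, (1 <= m <= k)%N -> alpha m <= 0).
Local Notation gamma := ((alpha k - 2^-1) ^+ 2).

(* The ground state corresponds to continuing the sequence by [alpha_{k+1} = 0], for which
   [beta_{k+1}] is the sharp constant. *)
Definition alpha_ext (m : nat) : R := if (0 < m <= k)%N then alpha m else 0.

Lemma alpha_ext_le0 m : alpha_ext m <= 0.
Proof. by rewrite /alpha_ext; case: ifP => // /alpha_le0. Qed.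

Lemma alpha_ext_last : alpha_ext k.+1 = 0.
Proof. by rewrite /alpha_ext ltnn. Qed.

Lemma hbeta_ext m : (1 <= m <= k)%N -> hbeta alpha_ext m = hbeta alpha m.
Proof.
move=> /andP[m1 mk]; rewrite /hbeta /alpha_ext k0 m1 mk /=.
have [//|m2] := eqVneq m 1%N.
have -> : (0 < m.-1)%N by move: m1 m2; case: m {mk} => [|[]].
by rewrite (leq_trans (leq_pred m) mk).
Qed.

Lemma hbeta_ext_last : hbeta alpha_ext k.+1 = gamma.
Proof.
by rewrite /hbeta eqSS (gtn_eqF k0) alpha_ext_last /= /alpha_ext k0 leqnn expr0n /= oppr0 add0r.
Qed.

(** Both bounds on the quotient come from here: the excess is nonnegative for every u and relatively
    small for suitable ones. *)
Lemma energy_deficit (u : 'rV[R]_n.+1 -> R) : C0inf_half u ->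
  iint (gradsq u) -
    \sum_(1 <= m < k.+1) hbeta alpha m * iint (fun x => u x ^+ 2 / rsq m x) =
  gamma * iint (fun x => u x ^+ 2 / rsq k.+1 x) + iint (excess alpha_ext k.+1 u).
Proof.
move=> uC; rewrite (hardy_identity alpha_ext kn uC) big_nat_recr //= hbeta_ext_last.
have -> : \sum_(1 <= m < k.+1) hbeta alpha_ext m * iint (fun x => u x ^+ 2 / rsq m x) =
    \sum_(1 <= m < k.+1) hbeta alpha m * iint (fun x => u x ^+ 2 / rsq m x).
  rewrite big_nat [RHS]big_nat; apply: eq_bigr => m mk; rewrite hbeta_ext //.
by set X := \sum_(1 <= m < k.+1) _; ring.
Qed.

Lemma sharp_testfun e : 0 < e -> exists u : 'rV[R]_n.+1 -> R,
  [/\ C0inf_half u, u <> (fun=> 0) &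
    iint (gradsq u) -
      \sum_(1 <= m < k.+1) hbeta alpha m * iint (fun x => u x ^+ 2 / rsq m x) <=
    (gamma + e) * iint (fun x => u x ^+ 2 / rsq k.+1 x)].
Proof.
move=> e0; have [u [uC u0 H]] := ex_testfun kn k0 alpha_ext_le0 alpha_ext_last e0.
by exists u; split=> //; rewrite energy_deficit // mulrDl lerD2l.
Qed.

Lemma sharp_upper (b : R) :
  (forall u : 'rV[R]_n.+1 -> R, C0inf_half u ->
     iint (fun x => (\sum_(1 <= m < k.+1) hbeta alpha m / rsq m x + b / rsq k.+1 x) * u x ^+ 2)
     <= iint (gradsq u)) -> b <= gamma.
Proof.
move=> H; apply/ler_addgt0Pr => e e0.
have [u [uC u0 Hu]] := sharp_testfun e0.
have D0 := iint_quot_gt0 (ltn0Sn k) uC u0.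
rewrite -(ler_pM2r D0); apply: le_trans Hu; rewrite lerBrDl.
(* The extra constant becomes the last term of one sequence, so that [iint_potential] treats all k +
   1 potentials at once. *)
pose c m := if m == k.+1 then b else hbeta alpha m.
have E (f : nat -> R) : \sum_(1 <= m < k.+1) hbeta alpha m * f m + b * f k.+1 =
    \sum_(1 <= m < k.+2) c m * f m.
  rewrite [RHS]big_nat_recr //= /c eqxx; congr (_ + _).
  rewrite big_nat [RHS]big_nat; apply: eq_bigr => m /andP[_ mk].
  by rewrite ltn_eqF.
rewrite (E (fun m => iint (fun x => u x ^+ 2 / rsq m x))) -(iint_potential c _ uC).
apply: le_trans (H u uC); rewrite le_eqVlt; apply/orP; left; apply/eqP.
by apply: eq_iint => x; rewrite -(E (fun m => (rsq m x)^-1)).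
Qed.

Lemma sharp_inf :
  inf [set (iint (gradsq u)
            - \sum_(1 <= m < k.+1) hbeta alpha m * iint (fun x => u x ^+ 2 / rsq m x))
           / iint (fun x => u x ^+ 2 / rsq k.+1 x)
       | u in [set u : 'rV[R]_n.+1 -> R | C0inf_half u /\ u <> (fun _ => 0)]] = gamma.
Proof.
set A := (X in inf X).
have lbA : lbound A gamma.
  move=> _ [u [uC u0] <-]; have D0 := iint_quot_gt0 (ltn0Sn k) uC u0.
  by rewrite (ler_pdivlMr _ _ D0) energy_deficit // lerDl; exact: iint_excess_ge0.
apply/eqP; rewrite eq_le; apply/andP; split; last first.
  (* The comparison with [inf] needs a nonempty set; the test function for tolerance 1 provides an
     element. *)
  apply: lb_le_inf => //; have [u [uC u0 _]] := sharp_testfun ltr01.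
  by eexists; exists u.
apply/ler_addgt0Pr => e e0; have [u [uC u0 H]] := sharp_testfun e0.
have D0 := iint_quot_gt0 (ltn0Sn k) uC u0.
rewrite -(ler_pdivrMr _ _ D0) in H; apply: le_trans H.
by apply: ge_inf; [exists gamma|exists u].
Qed.

End SharpConstant.

Unset Implicit Arguments.

Theorem theorem2p3 (R : realType) (n k : nat) (alpha : nat -> R) :
  (2 <= n)%N -> (1 <= k)%N -> (k <= n - 1)%N ->
  (forall m : nat, (1 <= m <= k)%N -> alpha m <= 0) ->
  (forall beta_k1 : R,
      (forall u : 'rV[R]_n -> R, C0inf_half u ->
         iint (fun x => (\sum_(1 <= m < k.+1) hbeta alpha m / rsq m x
                          + beta_k1 / rsq k.+1 x) * u x ^+ 2)
         <= iint (gradsq u)) ->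
      beta_k1 <= (alpha k - 2^-1) ^+ 2)
  /\
  inf [set (iint (gradsq u)
            - \sum_(1 <= m < k.+1) hbeta alpha m * iint (fun x => u x ^+ 2 / rsq m x))
           / iint (fun x => u x ^+ 2 / rsq k.+1 x)
       | u in [set u : 'rV[R]_n -> R | C0inf_half u /\ u <> (fun _ => 0)]]
  = (alpha k - 2^-1) ^+ 2.
Proof.
case: n => // n n2 k0; rewrite subn1 /= => kn alpha_le0.
have {}kn : (k < n.+1)%N by [].
split; first by move=> b; exact: sharp_upper kn k0 alpha_le0 b.
exact: sharp_inf kn k0 alpha_le0.
Qed.
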